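(* Let $\Pi$ be the Szegő projector on $S^1$, i.e. the orthogonal projection of $L^2(S^1)$ onto the closed span of $\{e^{in\theta}:n\ge0\}$. The algebra of differential operators on $S^1$ which commute with $\Pi$ has for its symbol algebra the algebra of polynomials on the cut space $(T^*S^1)_{++}=\mathbb C/\mathbb Z_2$. That is, with $\sigma:[0,\infty)\times S^1\to\mathbb C/\mathbb Z_2$, $\sigma(s,\lambda)=[\lambda^{-1/2}\sqrt s]$, the complex linear span of the principal symbols, restricted to $\{s\ge0\}\subset T^*S^1$, of differential operators on $S^1$ commuting with $\Pi$ equals $\{\sigma^*f: f \text{ a polynomial on } \mathbb C/\mathbb Z_2\}$.
   Context: Differential operators on $S^1$ have smooth complex coefficients. $T^*S^1=\mathbb R\times S^1$ with coordinates $(s,\lambda=e^{i\theta})$; the principal symbol of $\sum_{r=0}^df_r(\theta)\left(\frac1i\frac{d}{d\theta}\right)^r$ with $f_d\not\equiv0$ is $f_d(\theta)s^d$. $\mathbb Z_2$ acts on $\mathbb C$ by $z\mapsto-z$, $[z]$ denotes the class of $z$, and a polynomial on $\mathbb C/\mathbb Z_2$ is, by definition, a $\mathbb Z_2$-invariant complex-valued polynomial in $z,\bar z$ on $\mathbb C$. $(T^*S^1)_{++}$ is the quotient of $\{(s,\lambda,[z])\in\mathbb R\times S^1\times(\mathbb C/\mathbb Z_2):s=|z|^2\}$ by $\mu\cdot(s,\lambda,[z])=(s,\mu\lambda,[\sqrt\mu z])$, identified with $\mathbb C/\mathbb Z_2$ by $(s,\lambda,[z])\mapsto[\lambda^{-1/2}z]$;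 $\sigma$ is the composition of $(s,\lambda)\mapsto(s,\lambda,[\sqrt s])$ with this identification. *)

(* Defs.v *)
From HB Require Import structures.
From mathcomp Require Import all_boot all_order all_algebra.
From mathcomp Require Import generic_quotient.
From mathcomp Require Import all_classical all_reals all_analysis.
From mathcomp Require Import complex.

Set Implicit Arguments.
Unset Strict Implicit.
Unset Printing Implicit Defensive.

Import Order.TTheory GRing.Theory Num.Theory.
Import numFieldNormedType.Exports.

Local Open Scope classical_set_scope.
Local Open Scope quotient_scope.
Local Open Scope ring_scope.

Definition lin_span (K : pzRingType) (V : lmodType K) (A : set V) : set V :=
  [set v | exists (n : nat) (c : 'I_n -> K) (a : 'I_n -> V),
     (forall i, A (a i)) /\ v = \sum_(i < n) c i *: a i].

(* Functions on S^1 are written in the coordinate theta, that is, as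
   2 pi-periodic functions R -> R[i]. *)
Section FunctionsOnCircle.
Variable R : realType.
Implicit Types (u v w : R -> R[i]) (t : R).

Definition reF u : R -> R := fun t => complex.Re (u t).
Definition imF u : R -> R := fun t => complex.Im (u t).

Definition smooth_fun (f : R -> R) : Prop :=
  forall (n : nat) t, derivable (derive1n n f) t 1.

Definition circle_smooth u : Prop :=
  periodic u (2 * pi) /\ smooth_fun (reF u) /\ smooth_fun (imF u).

Definition cderive u : R -> R[i] :=
  fun t => Complex (derive1 (reF u) t) (derive1 (imF u) t).

(* 1 / i d / d theta *)
Definition Dtheta u : R -> R[i] := fun t => ('i%C)^-1 * cderive u t.

(* The measure on S^1 is d theta on [0, 2 pi]; normalising it would not affect
   orthogonality or closures. *)
Definition fund_dom : set R := `[0, 2 * pi].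

Definition circle_integral u : R[i] :=
  Complex (Rintegral lebesgue_measure fund_dom (reF u))
          (Rintegral lebesgue_measure fund_dom (imF u)).

Definition sqmod u : R -> R := fun t => reF u t ^+ 2 + imF u t ^+ 2.

Definition circle_L2 u : Prop :=
  [/\ periodic u (2 * pi),
      measurable_fun fund_dom (reF u),
      measurable_fun fund_dom (imF u) &
      (@lebesgue_measure R).-integrable fund_dom (EFin \o sqmod u)].

Definition L2inner u v : R[i] := circle_integral (fun t => u t * (v t)^*%C).

Definition L2norm u : R :=
  Num.sqrt (Rintegral lebesgue_measure fund_dom (sqmod u)).

Definition L2closure (A : set (R -> R[i])) : set (R -> R[i]) :=
  [set v | circle_L2 v /\
     forall eps : R, 0 < eps -> exists2 p, A p & L2norm (v - p) < eps].

Definition expi t : R[i] := Complex (cos t) (sin t).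

Definition fourier_mode (n : nat) : R -> R[i] := fun t => expi (n%:R * t).

Definition hardy : set (R -> R[i]) := L2closure (@lin_span R[i] _ (range fourier_mode)).

(* The graph of the Szego projector: [szego u v] says that v represents the
   orthogonal projection of the class of u.  It determines v only up to
   equality almost everywhere. *)
Definition szego u v : Prop :=
  [/\ circle_L2 u, hardy v & forall w, hardy w -> L2inner (u - v) w = 0].

(* [dcoef] may have identically zero leading coefficient, so that the zero
   operator is included; see [principal_symbol]. *)
Record diffop := Diffop {
  dorder : nat ;
  dcoef : 'I_dorder.+1 -> R -> R[i] ;
  dcoef_smooth : forall r, circle_smooth (dcoef r) }.

Definition dapply (P : diffop) u : R -> R[i] :=
  fun t => \sum_(r < (dorder P).+1) dcoef r t * iter r Dtheta u t.

(* P, with domain the smooth functions, commutes with the bounded operator Pi: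
   for every u in the domain, Pi u lies in the domain and P (Pi u) = Pi (P u)
   in L^2. *)
Definition commutes_with_szego (P : diffop) : Prop :=
  forall u, circle_smooth u ->
    exists v, [/\ circle_smooth v, szego u v & szego (dapply P u) (dapply P v)].

End FunctionsOnCircle.

Section CutSpace.
Variable R : realType.

Definition circle := {l : R[i] | `|l| == 1}.

Fact expi_norm (t : R) : `|expi t| == 1.
Proof. by rewrite normc_def /= cos2Dsin2 sqrtr1. Qed.

Definition circle_exp (t : R) : circle := exist _ (expi t) (expi_norm t).

(* g : T^*S^1 -> C in the coordinates (s, e^{i theta}). *)
Definition principal_symbol (P : diffop R) (g : R * circle -> R[i]) : Prop :=
  (exists t, dcoef (@ord_max (dorder P)) t != 0) /\
  forall (s t : R),
    g (s, circle_exp t) = dcoef (@ord_max (dorder P)) t * s%:C%C ^+ dorder P.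

Definition commuting_symbols : set (R * circle -> R[i]) :=
  [set g | exists2 P, commutes_with_szego P & principal_symbol P g].

Definition restrict_nonneg (g : R * circle -> R[i]) :
  {nonneg R} * circle -> R[i] := fun x => g (x.1%:num, x.2).

Definition sign_rel : rel R[i] := fun z w => (z == w) || (z == - w).

Fact sign_rel_refl : reflexive sign_rel.
Proof. by move=> z; rewrite /sign_rel eqxx. Qed.
Fact sign_rel_sym : symmetric sign_rel.
Proof.
by move=> z w; rewrite /sign_rel eq_sym; congr orb; rewrite eq_sym eqr_oppLR.
Qed.
Fact sign_rel_trans : transitive sign_rel.
Proof.
move=> y x z /orP[]/eqP-> // /orP[]/eqP->; rewrite /sign_rel ?opprK eqxx ?orbT//.
Qed.

Canonical sign_equiv := EquivRel sign_rel sign_rel_refl sign_rel_sym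
  sign_rel_trans.

Definition CmodZ2 := {eq_quot sign_equiv}.

Definition class_modZ2 (z : R[i]) : CmodZ2 := \pi_CmodZ2 z.

(* The lift f \o class_modZ2 of f to C is Z_2-invariant by construction. *)
Definition polynomials_modZ2 : set (CmodZ2 -> R[i]) :=
  [set f | exists p : {poly {poly R[i]}},
     forall z, f (class_modZ2 z) = p.[(z^*%C)%:P].[z]].

(* The class does not depend on which square root of l is chosen. *)
Definition sigma (x : {nonneg R} * circle) : CmodZ2 :=
  class_modZ2 ((sqrtC (sval x.2))^-1 * (Num.sqrt (x.1%:num))%:C%C).

End CutSpace.

(* Main.v *)
Require Import Defs.
From mathcomp Require Import all_boot all_order all_algebra.
From mathcomp Require Import generic_quotient.
From mathcomp Require Import all_classical all_reals all_analysis.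
From mathcomp Require Import measurable_realfun complex.
From mathcomp Require Import ring lra zify.

(** Write e_k for e^(i k theta) and D for (1/i) d/dtheta.  Let P = sum_r f_r D^r
have order at most d, and let f_r^(k) be the k-th Fourier coefficient of f_r.
The matrix coefficient of P from e_n to e_(n+k) is p_k(n), where
p_k = sum_r f_r^(k) X^r is a polynomial of degree at most d.  The projector
keeps e_n for n >= 0 and kills it for n < 0, so P commutes with it only if p_k
vanishes at every integer n for which exactly one of n and n + k is
nonnegative.  There are |k| such integers ([crossings]).

If |k| > d, then p_k has more roots than its degree allows, so p_k = 0: the
leading coefficient f_d has no frequency outside [-d, d], and since a continuous
function is determined by its Fourier coefficients ([fourier_uniqueness]), it
is a trigonometric polynomial of degree at most d ([leading_coef_trig]).

Conversely, if |k| <= d, there is a monic polynomial q of degree d that vanishes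
on the crossings of k, and e_k q(D) commutes with the projector
([mono_op_commutes]); its principal symbol is s^d lambda^k.  Thus the span of
the symbols, restricted to s >= 0, is the span of the functions s^d lambda^k
with |k| <= d.

On the cut space, z = lambda^(-1/2) sqrt(s) satisfies z zbar = s and
zbar^2 = s lambda, so that z^(d-k) zbar^(d+k) = s^d lambda^k
([cut_coord_monomial]).  The pairs (d - k, d + k) with |k| <= d are exactly the
pairs of exponents with even sum, and the monomials with these exponents span
the even polynomials in z and zbar; so both sides of the theorem are spanned
by the same functions.

Three analytic facts are behind this.  A continuous function that is orthogonal
to every e_n with n >= 0 is orthogonal to the whole L^2 closure ([hardy_ortho]).
The projection of a smooth function u is again smooth: it is the series of the
u^(n) e_n with n >= 0, which may be differentiated term by term because the
u^(n) decrease rapidly ([hardy_series_smooth], [szego_hardy_series]).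
Finally, e_k q(D) maps this series into the Hardy space because it maps each
partial sum into the span of the e_n with n >= 0 ([mono_op_hardy_series]). *)

Set Implicit Arguments.
Unset Strict Implicit.
Unset Printing Implicit Defensive.

Import Order.TTheory GRing.Theory Num.Theory.
Import numFieldNormedType.Exports.

Local Open Scope classical_set_scope.
Local Open Scope ring_scope.

(** * Integration over one period *)

Section Real_integral.
Variable R : realType.
Implicit Types (f g : R -> R).

Notation mu := (@lebesgue_measure R).
Notation D := (@fund_dom R).
Notation J f := (Rintegral mu D f).
Notation rint f := (mu.-integrable D (EFin \o f)).

Lemma measurable_fund_dom : measurable D.
Proof. exact: measurable_itv. Qed.
Hint Resolve measurable_fund_dom : core.

Lemma twopi_gt0 : 0 < 2 * pi :> R.
Proof. by rewrite mulr_gt0 ?pi_gt0. Qed.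

Lemma continuous_rint f : continuous f -> rint f.
Proof.
move=> cf; apply: continuous_compact_integrable; first exact: segment_compact.
exact: continuous_subspaceT.
Qed.

Lemma continuous_measurable_fund_dom f : continuous f -> measurable_fun D f.
Proof. by move=> cf; apply: measurable_funTS; exact: continuous_measurable_fun. Qed.

Lemma rint_dominated f g : measurable_fun D f -> rint g ->
  (forall t, D t -> `|f t| <= g t) -> rint f.
Proof.
move=> mf ig fg; apply: (@le_integrable _ _ _ mu D measurable_fund_dom _ (EFin \o g)) => //.
  exact/measurable_EFinP.
move=> t Dt; rewrite /= lee_fin (le_trans (fg t Dt))//; exact: ler_norm.
Qed.

Lemma rintD f g : rint f -> rint g -> rint (fun t => f t + g t).
Proof.
move=> If Ig.
have -> : EFin \o (fun t => f t + g t) = ((EFin \o f) \+ (EFin \o g))%E by [].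
exact: integrableD.
Qed.

Lemma rintZ (c : R) f : rint f -> rint (fun t => c * f t).
Proof.
move=> If.
have -> : EFin \o (fun t => c * f t) = (fun t => c%:E * (EFin \o f) t)%E by [].
exact: integrableZl.
Qed.

Lemma normr_Rintegral_le f g : rint f -> rint g ->
  (forall t, D t -> `|f t| <= g t) -> `|J f| <= J g.
Proof.
move=> If Ig fg; apply: (le_trans (le_normr_Rintegral _ If)) => //.
apply: le_Rintegral => //.
by have /integrable_norm := If.
Qed.

Lemma Rintegral_fund_dom_cst (c : R) : J (fun=> c) = c * (2 * pi).
Proof.
transitivity (c * fine (mu D)); first exact: Rintegral_cst.
by rewrite /fund_dom lebesgue_measure_itv /= lte_fin twopi_gt0 oppr0 adde0.
Qed.

(** A positive value persists, up to a factor 2, on a subinterval of positive length,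
which already makes the integral positive. *)
Lemma continuous_ge0_Rintegral_eq0 f : continuous f -> (forall t, D t -> 0 <= f t) ->
  J f <= 0 -> forall t, D t -> f t = 0.
Proof.
move=> cf f0 Jf t0 Dt0; apply/eqP; apply: contrapT => /negP ft0.
have {ft0}ft0 : 0 < f t0 by rewrite lt_neqAle eq_sym ft0 f0.
have /cvgrPdist_lt /(_ (f t0 / 2)) := cf t0.
rewrite divr_gt0// => /(_ isT) [e /= e0 He].
have {}He t : `|t0 - t| < e -> f t0 / 2 <= f t.
  by move=> /He; rewrite /= ltr_norml => /andP[_]; lra.
move: (Dt0); rewrite /fund_dom /= in_itv /= => /andP[a0 b0].
pose a := Num.max 0 (t0 - e / 2); pose b := Num.min (2 * pi) (t0 + e / 2).
have tp := twopi_gt0.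
have ab : a < b.
  by rewrite /a /b lt_min !gt_max; apply/andP; split; apply/andP; split; lra.
have abD : `[a, b] `<=` D.
  move=> t; rewrite /fund_dom /= !in_itv /= /a /b ge_max le_min.
  by move=> /andP[/andP[? ?] /andP[? ?]]; apply/andP.
have abf t : `[a, b]%classic t -> f t0 / 2 <= f t.
  rewrite /= in_itv /= /a /b ge_max le_min => /andP[/andP[? ?] /andP[? ?]].
  by apply: He; rewrite ltr_norml; apply/andP; split; lra.
have mab : measurable (`[a, b]%classic : set R) by exact: measurable_itv.
have If := continuous_rint cf.
have Iab : mu.-integrable `[a, b] (EFin \o f) by apply: integrableS If.
have : Rintegral mu `[a, b] (fun=> f t0 / 2) <= Rintegral mu `[a, b] f.
  apply: le_Rintegral => //.
  by apply: continuous_compact_integrable; [exact: segment_compact|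
     apply: continuous_subspaceT => x; exact: cvg_cst].
have -> : Rintegral mu `[a, b] (fun=> f t0 / 2) = f t0 / 2 * fine (mu `[a, b]).
  exact: Rintegral_cst.
have -> : fine (mu `[a, b]) = b - a by rewrite lebesgue_measure_itv /= lte_fin ab.
have : Rintegral mu `[a, b] f <= J f.
  rewrite /Rintegral fine_le//; [exact: integrable_fin_num..|].
  apply: ge0_subset_integral => //.
  by case/integrableP: If.
have : 0 < f t0 / 2 * (b - a) by rewrite mulr_gt0// ?divr_gt0// subr_gt0.
lra.
Qed.

Lemma Rintegral_fund_dom_derive f g :
  (forall t : R, is_derive t 1 f (g t)) -> continuous g ->
  J g = f (2 * pi) - f 0.
Proof.
move=> df cg.
have cf : continuous f.
  move=> t; apply: differentiable_continuous; apply/derivable1_diffP.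
  by case: (df t).
rewrite /Rintegral (@continuous_FTC2 _ g f 0 (2 * pi) twopi_gt0)//.
- exact: continuous_subspaceT.
- split; [by move=> t _; case: (df t)| |].
  + apply: cvg_at_right_filter; exact: cf.
  + apply: cvg_at_left_filter; exact: cf.
- by move=> t _; rewrite derive1E; case: (df t).
Qed.

Definition square_int f := measurable_fun D f /\ rint (fun t => f t ^+ 2).

Lemma continuous_square_int f : continuous f -> square_int f.
Proof.
move=> cf; split; first exact: continuous_measurable_fund_dom.
by apply: continuous_rint => t; apply: cvgM; exact: cf.
Qed.

(** Domination of |f g| by f^2 + g^2. *)
Lemma square_int_mul_rint f g : square_int f -> square_int g -> rint (fun t => f t * g t).
Proof.
move=> [mf If] [mg Ig]; apply: (rint_dominated _ (rintD If Ig)).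
  exact: measurable_funM.
by move=> t _; rewrite ler_norml; apply/andP; split; nra.
Qed.

Lemma square_intB f g : square_int f -> square_int g -> square_int (fun t => f t - g t).
Proof.
move=> sf sg; have Ifg := square_int_mul_rint sf sg; case: sf sg => [mf If] [mg Ig].
split; first exact: measurable_funB.
have -> : (fun t => (f t - g t) ^+ 2) =
  fun t => (f t ^+ 2 + g t ^+ 2) + (-2) * (f t * g t).
  by apply/funext => t; ring.
by apply: rintD; [exact: rintD|exact: rintZ].
Qed.

End Real_integral.

(** * Complex-valued functions on the circle and the modes e^(i k theta) *)

Section Complex_layer.
Variable R : realType.
Notation C := R[i].
Implicit Types (u v w a : R -> C) (z : C) (k j : int).

Notation Re := (@complex.Re R).
Notation Im := (@complex.Im R).
Notation normc := (@ComplexField.Normc.normc R).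
Notation mu := (@lebesgue_measure R).
Notation D := (@fund_dom R).
Notation J f := (Rintegral mu D f).
Notation rint f := (mu.-integrable D (EFin \o f)).
Notation CI := (@circle_integral R).
Notation expi := (@expi R).

Lemma ReM z z' : Re (z * z') = Re z * Re z' - Im z * Im z'.
Proof. by case: z z' => [a b] [c d]. Qed.
Lemma ImM z z' : Im (z * z') = Re z * Im z' + Im z * Re z'.
Proof. by case: z z' => [a b] [c d]. Qed.
Lemma ReD z z' : Re (z + z') = Re z + Re z'.
Proof. by case: z z' => [a b] [c d]. Qed.
Lemma ImD z z' : Im (z + z') = Im z + Im z'.
Proof. by case: z z' => [a b] [c d]. Qed.
Lemma ReN z : Re (- z) = - Re z. Proof. by case: z. Qed.
Lemma ImN z : Im (- z) = - Im z. Proof. by case: z. Qed.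
Lemma ReJ z : Re (z^*)%C = Re z. Proof. by case: z. Qed.
Lemma ImJ z : Im (z^*)%C = - Im z. Proof. by case: z. Qed.
Lemma complexP z z' : Re z = Re z' -> Im z = Im z' -> z = z'.
Proof. by case: z z' => [a b] [c d] /= -> ->. Qed.

Lemma normc_sqr z : normc z ^+ 2 = Re z ^+ 2 + Im z ^+ 2.
Proof. by case: z => a b /=; rewrite sqr_sqrtr// addr_ge0// sqr_ge0. Qed.

Lemma normc_ge0 z : 0 <= normc z.
Proof. by case: z => a b /=; exact: sqrtr_ge0. Qed.

Lemma normcR (x : R) : normc (x%:C)%C = `|x|.
Proof. by rewrite /= expr0n /= addr0 sqrtr_sqr. Qed.

Lemma normcD z z' : normc (z + z') <= normc z + normc z'.
Proof. exact: le_normcD. Qed.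

Lemma normc_sum (I : Type) (s : seq I) (F : I -> C) :
  normc (\sum_(i <- s) F i) <= \sum_(i <- s) normc (F i).
Proof.
elim/big_ind2: _ => [|z x z' x' h h'|//]; first by rewrite ComplexField.Normc.normc0.
exact: le_trans (normcD _ _) (lerD h h').
Qed.

Lemma Re_le_normc z : `|Re z| <= normc z.
Proof.
rewrite -(ger0_norm (normc_ge0 z)) -ler_sqr ?nnegrE// !real_normK ?num_real//.
by rewrite normc_sqr lerDl sqr_ge0.
Qed.
Lemma Im_le_normc z : `|Im z| <= normc z.
Proof.
rewrite -(ger0_norm (normc_ge0 z)) -ler_sqr ?nnegrE// !real_normK ?num_real//.
by rewrite normc_sqr lerDr sqr_ge0.
Qed.
Lemma normc_le_ReIm z : normc z <= `|Re z| + `|Im z|.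
Proof.
rewrite -ler_sqr ?nnegrE ?normc_ge0 ?addr_ge0// normc_sqr sqrrD !real_normK ?num_real//.
have := normr_ge0 (Re z); have := normr_ge0 (Im z); nra.
Qed.

(** Continuity, like integrability and differentiability below, is imposed on real and
imaginary parts: [smooth_fun] and [circle_integral] are themselves defined that way. *)
Definition ccont u := continuous (reF u) /\ continuous (imF u).

Lemma ccont_cst z : ccont (fun=> z).
Proof. by split=> x; exact: cvg_cst. Qed.

Lemma ccontD u v : ccont u -> ccont v -> ccont (fun t => u t + v t).
Proof.
move=> [ur ui] [vr vi]; split => x.
- have -> : reF (fun t => u t + v t) = reF u \+ reF v.
    by apply/funext => t; exact: ReD.
  by apply: cvgD; [exact: ur|exact: vr].
- have -> : imF (fun t => u t + v t) = imF u \+ imF v.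
    by apply/funext => t; exact: ImD.
  by apply: cvgD; [exact: ui|exact: vi].
Qed.

Lemma ccontM u v : ccont u -> ccont v -> ccont (fun t => u t * v t).
Proof.
move=> [ur ui] [vr vi]; split => x.
- have -> : reF (fun t => u t * v t) = (reF u \* reF v) \- (imF u \* imF v).
    by apply/funext => t; exact: ReM.
  by apply: cvgB; apply: cvgM; [exact: ur|exact: vr|exact: ui|exact: vi].
- have -> : imF (fun t => u t * v t) = (reF u \* imF v) \+ (imF u \* reF v).
    by apply/funext => t; exact: ImM.
  by apply: cvgD; apply: cvgM; [exact: ur|exact: vi|exact: ui|exact: vr].
Qed.

Lemma ccontJ u : ccont u -> ccont (fun t => (u t)^*%C).
Proof.
move=> [ur ui]; split => x.
- have -> : reF (fun t => (u t)^*%C) = reF u by apply/funext => t; exact: ReJ.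
  exact: ur.
- have -> : imF (fun t => (u t)^*%C) = \- imF u by apply/funext => t; exact: ImJ.
  by apply: cvgN; exact: ui.
Qed.

Lemma ccontZ z u : ccont u -> ccont (fun t => z * u t).
Proof. by move=> cu; apply: ccontM => //; exact: ccont_cst. Qed.

Lemma ccontB u v : ccont u -> ccont v -> ccont (fun t => u t - v t).
Proof.
move=> cu cv; have := ccontD cu (ccontZ (-1) cv).
by under eq_fun do rewrite mulN1r.
Qed.

Lemma ccont_sum (I : Type) (s : seq I) (F : I -> R -> C) :
  (forall i, ccont (F i)) -> ccont (fun t => \sum_(i <- s) F i t).
Proof.
move=> cF; elim: s => [|i s IH].
  by under eq_fun do rewrite big_nil; exact: ccont_cst.
by under eq_fun do rewrite big_cons; exact: ccontD.
Qed.

Definition cintegrable u := rint (reF u) /\ rint (imF u).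

Lemma ccont_cintegrable u : ccont u -> cintegrable u.
Proof. by move=> [? ?]; split; exact: continuous_rint. Qed.

Lemma circle_integralD u v : cintegrable u -> cintegrable v ->
  CI (fun t => u t + v t) = CI u + CI v.
Proof.
move=> [ur ui] [vr vi]; apply: complexP; rewrite ?ReD ?ImD /=.
- rewrite -RintegralD//; last exact: measurable_fund_dom.
  by congr Rintegral; apply/funext => t; exact: ReD.
- rewrite -RintegralD//; last exact: measurable_fund_dom.
  by congr Rintegral; apply/funext => t; exact: ImD.
Qed.

Lemma circle_integralZ z u : cintegrable u -> CI (fun t => z * u t) = z * CI u.
Proof.
move=> [ur ui]; apply: complexP; rewrite ?ReM ?ImM /=.
- rewrite -!RintegralZl//; try exact: measurable_fund_dom.
  rewrite -RintegralB; [|exact: measurable_fund_dom|exact: rintZ|exact: rintZ].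
  by congr Rintegral; apply/funext => t; exact: ReM.
- rewrite -!RintegralZl//; try exact: measurable_fund_dom.
  rewrite -RintegralD; [|exact: measurable_fund_dom|exact: rintZ|exact: rintZ].
  by congr Rintegral; apply/funext => t; exact: ImM.
Qed.

Lemma cintegrableZ z u : cintegrable u -> cintegrable (fun t => z * u t).
Proof.
move=> [ur ui]; split.
- have -> : reF (fun t => z * u t) = fun t => Re z * reF u t + (- Im z) * imF u t.
    by apply/funext => t; rewrite /reF ReM mulNr.
  by apply: rintD; exact: rintZ.
- have -> : imF (fun t => z * u t) = fun t => Re z * imF u t + Im z * reF u t.
    by apply/funext => t; rewrite /imF ImM.
  by apply: rintD; exact: rintZ.
Qed.

Lemma circle_integralB u v : cintegrable u -> cintegrable v ->
  CI (fun t => u t - v t) = CI u - CI v.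
Proof.
move=> iu iv; have := circle_integralD iu (cintegrableZ (-1) iv).
rewrite circle_integralZ// mulN1r => <-.
by congr circle_integral; apply/funext => t; rewrite mulN1r.
Qed.

Lemma circle_integral0 : CI (fun=> 0) = 0.
Proof. by apply: complexP => /=; rewrite Rintegral_fund_dom_cst mul0r. Qed.

Lemma circle_integral_sum (I : Type) (s : seq I) (F : I -> R -> C) :
  (forall i, ccont (F i)) -> CI (fun t => \sum_(i <- s) F i t) = \sum_(i <- s) CI (F i).
Proof.
move=> cF; elim: s => [|i s IH].
  by rewrite big_nil; under eq_fun do rewrite big_nil; exact: circle_integral0.
rewrite big_cons -IH -circle_integralD; try (apply: ccont_cintegrable => //; exact: ccont_sum).
by congr circle_integral; apply/funext => t; rewrite big_cons.
Qed.

(** The constant 4 pi is twice the length of the period: the real and the imaginary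
part are each bounded by M. *)
Lemma circle_integral_bound u (M : R) : cintegrable u ->
  (forall t, D t -> normc (u t) <= M) ->
  normc (CI u) <= 4 * pi * M.
Proof.
move=> [ur ui] uM; apply: le_trans (normc_le_ReIm _) _ => /=.
have IM : rint (fun _ : R => M) by apply: continuous_rint => x; exact: cvg_cst.
have := normr_Rintegral_le ur IM (fun t Dt => le_trans (Re_le_normc _) (uM t Dt)).
have := normr_Rintegral_le ui IM (fun t Dt => le_trans (Im_le_normc _) (uM t Dt)).
by rewrite Rintegral_fund_dom_cst; lra.
Qed.

Definition has_cderive u du := forall t : R,
  is_derive t 1 (reF u) (reF du t) /\ is_derive t 1 (imF u) (imF du t).

Lemma eq_has_cderive u du du' : has_cderive u du -> du =1 du' -> has_cderive u du'.
Proof. by move=> h /funext <-. Qed.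

Lemma has_cderiveM u v du dv : has_cderive u du -> has_cderive v dv ->
  has_cderive (fun t => u t * v t) (fun t => du t * v t + u t * dv t).
Proof.
move=> du' dv' t; have [ur ui] := du' t; have [vr vi] := dv' t; split.
- have -> : reF (fun t => u t * v t) = (reF u * reF v) - (imF u * imF v).
    by apply/funext => s; exact: ReM.
  apply: is_derive_eq; rewrite /reF ReD !ReM /GRing.scale /= /imF /reF; ring.
- have -> : imF (fun t => u t * v t) = (reF u * imF v) + (imF u * reF v).
    by apply/funext => s; exact: ImM.
  apply: is_derive_eq; rewrite /imF ImD !ImM /GRing.scale /= /imF /reF; ring.
Qed.

Lemma has_cderive_cst z : has_cderive (fun=> z) (fun=> 0).
Proof. by move=> t; split; exact: is_derive_cst. Qed.

Lemma has_cderiveZ z u du : has_cderive u du -> has_cderive (fun t => z * u t) (fun t => z * du t).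
Proof.
move=> h; apply: eq_has_cderive (has_cderiveM (has_cderive_cst z) h) _ => t.
by rewrite mul0r add0r.
Qed.

Lemma has_cderiveD u v du dv : has_cderive u du -> has_cderive v dv ->
  has_cderive (fun t => u t + v t) (fun t => du t + dv t).
Proof.
move=> du' dv' t; have [ur ui] := du' t; have [vr vi] := dv' t; split.
- have -> : reF (fun t => u t + v t) = reF u + reF v.
    by apply/funext => s; exact: ReD.
  by apply: is_derive_eq; rewrite /reF ReD.
- have -> : imF (fun t => u t + v t) = imF u + imF v.
    by apply/funext => s; exact: ImD.
  by apply: is_derive_eq; rewrite /imF ImD.
Qed.

Lemma has_cderive_sum (I : Type) (s : seq I) (F F' : I -> R -> C) :
  (forall i, has_cderive (F i) (F' i)) ->
  has_cderive (fun t => \sum_(i <- s) F i t) (fun t => \sum_(i <- s) F' i t).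
Proof.
move=> cF; elim: s => [|i s IH].
  under eq_fun do rewrite big_nil.
  by apply: eq_has_cderive (has_cderive_cst 0) _ => t; rewrite big_nil.
under eq_fun do rewrite big_cons.
by apply: eq_has_cderive (has_cderiveD (cF i) IH) _ => t; rewrite big_cons.
Qed.

Lemma has_cderive_ccont u du : has_cderive u du -> ccont u.
Proof.
by move=> h; split=> t; apply: differentiable_continuous; apply/derivable1_diffP;
   case: (h t) => [[? _] [? _]].
Qed.

Lemma cderiveE u du : has_cderive u du -> cderive u = du.
Proof.
move=> h; apply/funext => t; case: (h t) => h1 h2.
by apply: complexP => /=; rewrite derive1E derive_val.
Qed.

(** The fundamental theorem of calculus on one period, where the two boundary terms
agree. *)
Lemma circle_integral_derivative u du : has_cderive u du -> ccont du ->
  periodic u (2 * pi) -> CI du = 0.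
Proof.
move=> h [dr di] pu.
have Pu : u (2 * pi) = u 0 by rewrite -[X in u X]add0r pu.
apply: complexP => /=.
- by rewrite (Rintegral_fund_dom_derive (fun t => (h t).1) dr) /reF Pu subrr.
- by rewrite (Rintegral_fund_dom_derive (fun t => (h t).2) di) /imF Pu subrr.
Qed.

(** Integer powers of e^(i t), rather than e^(i k t), make the multiplication rule and
the periodicity immediate; [zmodeE] gives the other form. *)
Definition zmode (k : int) : R -> C := fun t => expi t ^ k.

Lemma expiD s t : expi (s + t) = expi s * expi t.
Proof.
by apply: complexP; rewrite ?ReM ?ImM /= ?cosD ?sinD; ring.
Qed.

Lemma expi0 : expi 0 = 1. Proof. by rewrite /Defs.expi cos0 sin0. Qed.

Lemma expiJ t : ((expi t)^*)%C = expi (- t).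
Proof. by rewrite /Defs.expi /= cosN sinN. Qed.

Lemma expiN t : expi (- t) = (expi t)^-1.
Proof.
have h : expi (- t) * expi t = 1 by rewrite -expiD addNr expi0.
by rewrite -[RHS]mul1r -h -mulrA divff ?mulr1//; apply: contraTN isT => /eqP e;
  move/eqP: h; rewrite e mulr0 eq_sym oner_eq0.
Qed.

Lemma expi_unit t : expi t != 0.
Proof.
apply/eqP => e; have : expi (- t) * expi t = 1 by rewrite -expiD addNr expi0.
by rewrite e mulr0 => /eqP; rewrite eq_sym oner_eq0.
Qed.

Lemma zmodeE k t : zmode k t = expi (k%:~R * t).
Proof.
have hn (n : nat) s : expi s ^+ n = expi (n%:R * s).
  elim: n => [|n IH]; first by rewrite mul0r expi0.
  by rewrite exprS IH -expiD mulrS mulrDl mul1r.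
case: k => n; first by rewrite /zmode -exprnP hn.
by rewrite /zmode NegzE -exprnN hn -expiN mulrNz mulNr.
Qed.

Lemma zmode_fourier_mode (n : nat) : zmode n = fourier_mode n.
Proof. by apply/funext => t; rewrite zmodeE. Qed.

Lemma zmodeD j k t : zmode (j + k) t = zmode j t * zmode k t.
Proof. by rewrite /zmode expfzDr// expi_unit. Qed.

Lemma zmode0 t : zmode 0 t = 1. Proof. by rewrite /zmode expr0z. Qed.

Lemma zmodeJ k t : ((zmode k t)^*)%C = zmode (- k) t.
Proof. by rewrite !zmodeE expiJ mulrNz mulNr. Qed.

Lemma zmode_periodic k : periodic (zmode k) (2 * pi).
Proof.
move=> t; rewrite /zmode expiD (_ : expi (2 * pi) = 1) ?mulr1//.
by rewrite mulr_natl /Defs.expi cos2pi sin2pi.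
Qed.

Lemma normc_zmode k t : normc (zmode k t) = 1.
Proof. by rewrite zmodeE /= cos2Dsin2 sqrtr1. Qed.

Lemma zmode_has_cderive k : has_cderive (zmode k) (fun t => 'i%C * k%:~R * zmode k t).
Proof.
move=> t.
have kE : (k%:~R : C) = ((k%:~R : R)%:C)%C by rewrite rmorph_int.
split.
- have -> : reF (zmode k) = (@cos R \o ( *%R k%:~R)).
    by apply/funext => s; rewrite /reF zmodeE.
  rewrite /reF zmodeE kE !(ReM, ImM) /=.
  apply: is_derive_eq; rewrite /GRing.scale /=; ring.
- have -> : imF (zmode k) = (@sin R \o ( *%R k%:~R)).
    by apply/funext => s; rewrite /imF zmodeE.
  rewrite /imF zmodeE kE !(ReM, ImM) /=.
  apply: is_derive_eq; rewrite /GRing.scale /=; ring.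
Qed.

Lemma zmode_ccont k : ccont (zmode k).
Proof. exact: has_cderive_ccont (zmode_has_cderive k). Qed.

Lemma imaginary_neq0 : 'i%C != 0 :> C.
Proof. by rewrite eq_complex /= oner_eq0 andbF. Qed.

(** For k != 0 the mode is the derivative of a periodic function. *)
Lemma circle_integral_zmode k : CI (zmode k) = if k == 0 then (2 * pi)%:C%C else 0.
Proof.
case: eqVneq => [->|k0].
  have -> : zmode 0 = fun=> 1 by apply/funext => t; rewrite zmode0.
  by apply: complexP => /=; rewrite Rintegral_fund_dom_cst ?mul1r ?mul0r.
have := circle_integral_derivative (zmode_has_cderive k) (ccontZ _ (zmode_ccont k)) (zmode_periodic k).
rewrite circle_integralZ; last exact: ccont_cintegrable (zmode_ccont k).
move/eqP; rewrite !mulf_eq0 (negPf imaginary_neq0) intr_eq0 (negPf k0) /=.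
by move/eqP.
Qed.

End Complex_layer.

(** * Orthogonality to the Hardy space *)

Section Hardy.
Variable R : realType.
Notation C := R[i].
Implicit Types (u v w a b p : R -> C) (z : C) (k j : int).

Notation Re := (@complex.Re R).
Notation Im := (@complex.Im R).
Notation normc := (@ComplexField.Normc.normc R).
Notation mu := (@lebesgue_measure R).
Notation D := (@fund_dom R).
Notation J f := (Rintegral mu D f).
Notation rint f := (mu.-integrable D (EFin \o f)).
Notation CI := (@circle_integral R).
Notation zmode := (@zmode R).
Notation span := (@lin_span C _ (range (@fourier_mode R))).

(** The part of [circle_L2] that is stable under subtraction without periodicity, in
the form in which products can be shown integrable. *)
Definition csquare_int u := square_int (reF u) /\ square_int (imF u).

Lemma ccont_csquare_int u : ccont u -> csquare_int u.
Proof. by move=> [? ?]; split; exact: continuous_square_int. Qed.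

Lemma circle_L2_csquare_int u : circle_L2 u -> csquare_int u.
Proof.
move=> [_ mr mi Iu]; split; split => //.
- apply: rint_dominated Iu _; first exact: measurable_funX.
  by move=> t _; rewrite ger0_norm ?sqr_ge0// lerDl sqr_ge0.
- apply: rint_dominated Iu _; first exact: measurable_funX.
  by move=> t _; rewrite ger0_norm ?sqr_ge0// lerDr sqr_ge0.
Qed.

Lemma csquare_int_circle_L2 u : csquare_int u -> periodic u (2 * pi) -> circle_L2 u.
Proof. by move=> [[mr ir] [mi ii]] pu; split => //; exact: rintD. Qed.

Lemma csquare_intB u v : csquare_int u -> csquare_int v -> csquare_int (u - v).
Proof.
move=> [ur ui] [vr vi]; split.
- have -> : reF (u - v) = fun t => reF u t - reF v t.
    by apply/funext => t; rewrite /reF -ReN -ReD.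
  exact: square_intB.
- have -> : imF (u - v) = fun t => imF u t - imF v t.
    by apply/funext => t; rewrite /imF -ImN -ImD.
  exact: square_intB.
Qed.

Lemma csquare_int_cintegrable u v : csquare_int u -> csquare_int v ->
  cintegrable (fun t => u t * (v t)^*%C).
Proof.
move=> [ur ui] [vr vi]; split.
- have -> : reF (fun t => u t * (v t)^*%C) =
    fun t => reF u t * reF v t + imF u t * imF v t.
    by apply/funext => t; rewrite /reF ReM ReJ ImJ mulrN opprK.
  by apply: rintD; exact: square_int_mul_rint.
- have -> : imF (fun t => u t * (v t)^*%C) =
    fun t => imF u t * reF v t + (-1) * (reF u t * imF v t).
    by apply/funext => t; rewrite /imF ImM ReJ ImJ /reF; ring.
  by apply: rintD; [|apply: rintZ]; exact: square_int_mul_rint.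
Qed.

Lemma csquare_int_sqmod_rint u : csquare_int u -> rint (sqmod u).
Proof. by move=> [[_ ?] [_ ?]]; exact: rintD. Qed.

Lemma sqmodE u t : sqmod u t = normc (u t) ^+ 2.
Proof. by rewrite normc_sqr. Qed.

Lemma Rintegral_sqmod u : J (sqmod u) = L2norm u ^+ 2.
Proof.
rewrite sqr_sqrtr// Rintegral_ge0// => t _.
by rewrite addr_ge0 ?sqr_ge0.
Qed.

(** A substitute for the Cauchy-Schwarz inequality: integrating
2 |a b| <= e |a|^2 + |b|^2 / e separately in the real and the imaginary part
suffices for limit arguments. *)
Lemma L2inner_young a b (e : R) : 0 < e -> csquare_int a -> csquare_int b ->
  normc (L2inner a b) <= e * J (sqmod a) + e^-1 * L2norm b ^+ 2.
Proof.
move=> e0 sa sb; rewrite -Rintegral_sqmod; have iab := csquare_int_cintegrable sa sb.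
apply: le_trans (normc_le_ReIm _) _ => /=.
have Ia := csquare_int_sqmod_rint sa; have Ib := csquare_int_sqmod_rint sb.
have key (x y x' y' : R) :
  `|x * x' + y * y'| <= e / 2 * (x ^+ 2 + y ^+ 2) + e^-1 / 2 * (x' ^+ 2 + y' ^+ 2).
  (* s = 1 and s = -1 give the two sides of the absolute value *)
  have h s : 2 * s * (x * x' + y * y') <= e * (x ^+ 2 + y ^+ 2)
      + e^-1 * (s * s) * (x' ^+ 2 + y' ^+ 2).
    have -> : e * (x ^+ 2 + y ^+ 2) + e^-1 * (s * s) * (x' ^+ 2 + y' ^+ 2)
      = e^-1 * ((e * x - s * x') ^+ 2 + (e * y - s * y') ^+ 2)
        + 2 * s * (x * x' + y * y').
      by field; rewrite gt_eqF.
    by rewrite lerDr mulr_ge0// ?invr_ge0 ?(ltW e0)// addr_ge0// sqr_ge0.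
  have := h 1; have := h (-1); rewrite !mulrNN !mulr1.
  by rewrite ler_norml => h1 h2; apply/andP; split; lra.
have Is : rint (fun t => e / 2 * sqmod a t + e^-1 / 2 * sqmod b t).
  by apply: rintD; exact: rintZ.
have b1 : `|J (reF (fun t => a t * (b t)^*%C))| <=
    J (fun t => e / 2 * sqmod a t + e^-1 / 2 * sqmod b t).
  apply: normr_Rintegral_le => //; first by case: iab.
  move=> t _; rewrite /sqmod /reF ReM ReJ ImJ mulrN opprK; exact: key.
have b2 : `|J (imF (fun t => a t * (b t)^*%C))| <=
    J (fun t => e / 2 * sqmod a t + e^-1 / 2 * sqmod b t).
  apply: normr_Rintegral_le => //; first by case: iab.
  move=> t _; rewrite /sqmod /imF ImM ReJ ImJ.
  have := key (Im (a t)) (- Re (a t)) (Re (b t)) (Im (b t)).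
  rewrite sqrrN [Im (a t) ^+ 2 + _]addrC; congr (`|_| <= _); rewrite /reF; ring.
apply: le_trans (lerD b1 b2) _.
rewrite RintegralD; [|exact: measurable_fund_dom|exact: rintZ|exact: rintZ].
by rewrite !RintegralZl//; try exact: measurable_fund_dom; lra.
Qed.

Lemma spanP p : span p -> exists n (c : 'I_n -> C) (m : 'I_n -> nat),
  p = fun t => \sum_(i < n) c i * zmode (m i) t.
Proof.
move=> [n [c [f [hf ->]]]].
have hf' i : exists m : nat, f i = zmode m.
  by have [m _ <-] := hf i; exists m; rewrite zmode_fourier_mode.
have [m hm] := choice hf'.
exists n, c, m; apply/funext => t; rewrite fct_sumE; apply: eq_bigr => i _.
by rewrite -hm.
Qed.

Lemma span_sum n (c : 'I_n -> C) (m : 'I_n -> nat) :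
  span (fun t => \sum_(i < n) c i * zmode (m i) t).
Proof.
exists n, c, (fun i => zmode (m i)); split.
  by move=> i; exists (m i) => //; rewrite zmode_fourier_mode.
by apply/funext => t; rewrite fct_sumE.
Qed.

Lemma span_ccont p : span p -> ccont p.
Proof.
move=> /spanP[n [c [m ->]]]; apply: ccont_sum => i; exact/ccontZ/zmode_ccont.
Qed.

Lemma L2inner_span a p : ccont a -> (forall n : nat, L2inner a (zmode n) = 0) ->
  span p -> L2inner a p = 0.
Proof.
move=> ca h /spanP[n [c [m ->]]]; rewrite /L2inner.
have -> : (fun t => a t * ((\sum_(i < n) c i * zmode (m i) t)^*)%C) =
  fun t => \sum_(i < n) (c i)^*%C * (a t * (zmode (m i) t)^*%C).
  apply/funext => t; rewrite rmorph_sum mulr_sumr; apply: eq_bigr => i _.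
  by rewrite rmorphM /= mulrCA.
have cc i : ccont (fun t => a t * (zmode (m i) t)^*%C).
  by apply: ccontM => //; apply: ccontJ; exact: zmode_ccont.
rewrite circle_integral_sum; last by move=> i; exact: ccontZ.
rewrite big1// => i _; rewrite circle_integralZ; last exact: ccont_cintegrable.
by have := h (m i); rewrite /L2inner => ->; rewrite mulr0.
Qed.

(** Elements of the Hardy space are L^2 limits of combinations of the modes, and the
inner product with a fixed continuous function is continuous in the L^2 norm. *)
Lemma hardy_ortho a w : ccont a -> (forall n : nat, L2inner a (zmode n) = 0) ->
  hardy w -> L2inner a w = 0.
Proof.
move=> ca h [L2w hw].
apply: ComplexField.Normc.eq0_normc; apply/eqP; rewrite eq_le normc_ge0 andbT.
apply/ler_addgt0Pl => eps eps0; rewrite addr0.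
pose A := J (sqmod a).
have A0 : 0 <= A by apply: Rintegral_ge0 => t _; rewrite addr_ge0 ?sqr_ge0.
(* chosen so that e A + e = eps, the two terms of L2inner_young *)
pose e := eps / (A + 1).
have e0 : 0 < e by rewrite divr_gt0// ltr_wpDl.
have [p sp hp] := hw e e0.
have cp := span_ccont sp.
have sa := ccont_csquare_int ca; have sw := circle_L2_csquare_int L2w; have spq := ccont_csquare_int cp.
have -> : L2inner a w = L2inner a (w - p).
  have -> : L2inner a w = L2inner a p + L2inner a (w - p).
    rewrite /L2inner -circle_integralD; last 2 first.
    - exact: csquare_int_cintegrable.
    - exact/csquare_int_cintegrable/csquare_intB.
    by congr circle_integral; apply/funext => t; rewrite -mulrDr -rmorphD /= addrC subrK.
  by rewrite L2inner_span// add0r.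
apply: le_trans (L2inner_young e0 sa (csquare_intB sw spq)) _.
have n0 : 0 <= L2norm (w - p) by exact: sqrtr_ge0.
have : L2norm (w - p) ^+ 2 <= e ^+ 2 by rewrite ler_sqr ?nnegrE ?(ltW e0)// ltW.
rewrite -(ler_pM2l (_ : 0 < e^-1)) ?invr_gt0// expr2 mulKf ?gt_eqF// => h2.
apply: le_trans (lerD (lexx _) h2) _.
by rewrite -/A /e -[X in _ + X]mulr1 -mulrDr divfK// gt_eqF// ltr_wpDl.
Qed.

(** Uniform convergence on the circle implies convergence in L^2. *)
Lemma hardy_unif w : ccont w -> periodic w (2 * pi) ->
  (forall e : R, 0 < e -> exists2 p, span p & forall t, normc (w t - p t) <= e) ->
  hardy w.
Proof.
move=> cw pw h; split; first by apply: csquare_int_circle_L2 => //; exact: ccont_csquare_int.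
move=> eps eps0; have tp := twopi_gt0 R.
pose e := eps / (1 + 2 * pi) / 2.
have e0 : 0 < e by rewrite /e divr_gt0// divr_gt0//; lra.
have [p sp hp] := h e e0; exists p => //.
have sq : csquare_int (w - p) by apply: csquare_intB; apply: ccont_csquare_int => //; exact: span_ccont.
rewrite -ltr_sqr ?nnegrE ?(ltW eps0) ?sqrtr_ge0// -Rintegral_sqmod.
have : `|J (sqmod (w - p))| <= J (fun=> e ^+ 2).
  apply: normr_Rintegral_le; first exact: csquare_int_sqmod_rint.
    by apply: continuous_rint => x; exact: cvg_cst.
  move=> t _; rewrite sqmodE ger0_norm ?sqr_ge0// ler_sqr ?nnegrE ?normc_ge0 ?(ltW e0)//.
  exact: hp.
rewrite Rintegral_fund_dom_cst => /(le_trans (ler_norm _)) /le_lt_trans; apply.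
have -> : eps = 2 * (1 + 2 * pi) * e by rewrite /e; field; lra.
have -> : (2 * (1 + 2 * pi) * e) ^+ 2 = e ^+ 2 * (4 * (1 + 2 * pi) ^+ 2) by ring.
rewrite ltr_pM2l ?exprn_gt0//; nra.
Qed.

Lemma zmode_hardy (n : nat) : hardy (zmode n).
Proof.
apply: hardy_unif; [exact: zmode_ccont|exact: zmode_periodic|].
move=> e e0; exists (zmode n).
  have -> : zmode n = fun t => \sum_(i < 1) 1 * zmode n t.
    by apply/funext => t; rewrite big_ord1 mul1r.
  exact: (span_sum (fun=> 1) (fun=> n)).
by move=> t; rewrite subrr ComplexField.Normc.normc0 ltW.
Qed.

End Hardy.

(** * Uniqueness of Fourier coefficients *)

Section Completeness.
Variable R : realType.
Notation C := R[i].
Implicit Types (u v w a b p : R -> C) (z : C) (k j : int).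

Notation Re := (@complex.Re R).
Notation Im := (@complex.Im R).
Notation normc := (@ComplexField.Normc.normc R).
Notation mu := (@lebesgue_measure R).
Notation D := (@fund_dom R).
Notation J f := (Rintegral mu D f).
Notation rint f := (mu.-integrable D (EFin \o f)).
Notation CI := (@circle_integral R).
Notation zmode := (@zmode R).

Lemma periodic_int (V : zmodType) (f : R -> V) (c : R) k t :
  periodic f c -> f (t + k%:~R * c) = f t.
Proof.
move=> pf; have hn (n : nat) s : f (s + n%:R * c) = f s.
  elim: n s => [|n IH] s; first by rewrite mul0r addr0.
  by rewrite mulrS mulrDl mul1r [c + _]addrC addrA pf IH.
case: k => n; first exact: hn.
by rewrite -(hn n.+1) NegzE mulrNz mulNr addrNK.
Qed.

(** Used to move a point into [0, 2 pi] and a difference of points into [-pi, pi]. *)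
Lemma shift_to_period (x c : R) : exists k, c <= x + k%:~R * (2 * pi) <= c + 2 * pi.
Proof.
have tp := twopi_gt0 R; move: (2 * pi) tp => T T0.
exists (- Num.floor ((x - c) / T)); rewrite mulrNz.
have := floor_le ((x - c) / T); have := floorD1_gt ((x - c) / T).
set m := Num.floor _; rewrite ltr_pdivrMr// ler_pdivlMr// rmorphD /= => h1 h2.
by apply/andP; split; lra.
Qed.

Lemma continuous_bounded_fund_dom (f : R -> R) : continuous f ->
  exists M, forall t, D t -> `|f t| <= M.
Proof.
move=> cf; have cn : continuous (fun t => `|f t|).
  by move=> t; apply: cvg_norm; exact: cf.
have [c _ hc] := EVT_max (ltW (twopi_gt0 R)) (continuous_subspaceT cn).
by exists `|f c| => t Dt; exact: hc.
Qed.

Lemma bernoulli_ineq (x : R) (n : nat) : 1 <= x -> n%:R * (x - 1) <= x ^+ n.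
Proof.
move=> x1; suff : 1 + n%:R * (x - 1) <= x ^+ n by lra.
elim: n => [|n IH]; first by rewrite mul0r addr0 expr0.
rewrite exprS; apply: (@le_trans _ _ (x * (1 + n%:R * (x - 1)))); last first.
  by rewrite ler_wpM2l//; lra.
have : 0 <= n%:R * (x - 1) ^+ 2 by rewrite mulr_ge0// sqr_ge0.
rewrite -[n.+1]addn1 natrD; move: (n%:R : R) => y; nra.
Qed.

(** A neighbourhood of t0 modulo 2 pi is the set where cos (t - t0) is close to 1; this
turns continuity at t0 into a statement about cos (t - t0) on the whole circle. *)
Lemma near_maximum_cos (h : R -> R) (t0 : R) : continuous h ->
  periodic h (2 * pi) -> 0 < h t0 ->
  exists2 r, 0 < r < 2 & forall t, 1 - r < cos (t - t0) -> h t0 / 2 < h t.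
Proof.
move=> ch ph h0; have pi0 := pi_gt0 R.
have /cvgrPdist_lt /(_ (h t0 / 2)) := ch t0.
rewrite divr_gt0// => /(_ isT) [e /= e0 He].
(* eta < pi gives r < 2 *)
pose eta := Num.min e (pi / 2).
have eta0 : 0 < eta by rewrite lt_min e0 divr_gt0.
have eta1 : eta < pi by rewrite gt_min; apply/orP; right; lra.
have ein : eta \in `[0, pi] by rewrite in_itv /= (ltW eta0) (ltW eta1).
have c1 : cos eta < 1.
  by rewrite -cos0 ltr_cos// in_itv /= lexx ltW.
have c2 : -1 < cos eta.
  by rewrite -cospi ltr_cos// in_itv /= lexx ltW.
exists (1 - cos eta); first by apply/andP; split; lra.
move=> t; have -> : 1 - (1 - cos eta) = cos eta by ring.
have [k /andP[k1 k2]] := shift_to_period (t - t0) (- pi).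
have -> : cos (t - t0) = cos `|t - t0 + k%:~R * (2 * pi)|.
  rewrite cos_norm; symmetry; apply: periodic_int => s.
  by rewrite mulr_natl cosD2pi.
rewrite ltr_cos//; last first.
  by rewrite in_itv /= normr_ge0 /= ler_norml; apply/andP; split; lra.
move=> hx; rewrite -(periodic_int k t ph).
have : `|t0 - (t + k%:~R * (2 * pi))| < e.
  rewrite distrC; have -> : t + k%:~R * (2 * pi) - t0 = t - t0 + k%:~R * (2 * pi) by ring.
  by apply: lt_le_trans hx _; rewrite ge_min lexx.
by move=> /He; rewrite /= ltr_norml => /andP[_]; lra.
Qed.

(** Multiplying by al + be e_1 + ga e_(-1) only shifts frequencies, so orthogonality to
all modes is preserved by multiplication with its powers. *)
Lemma ortho_cos_power u (al be ga : C) : ccont u ->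
  (forall k, CI (fun t => u t * zmode k t) = 0) ->
  forall N k,
  CI (fun t => u t * (al + be * zmode 1 t + ga * zmode (-1) t) ^+ N * zmode k t) = 0.
Proof.
move=> cu hu N k; set q := fun t => al + be * zmode 1 t + ga * zmode (-1) t.
have cq : ccont q.
  by apply: ccontD; [apply: ccontD; [exact: ccont_cst|]|]; exact/ccontZ/zmode_ccont.
have cN n : ccont (fun t => u t * q t ^+ n).
  elim: n => [|n IH]; first by under eq_fun do rewrite expr0 mulr1.
  by under eq_fun do rewrite exprSr mulrA; exact: ccontM.
elim: N k => [|N IH] k.
  by rewrite -(hu k); congr circle_integral; apply/funext => t; rewrite expr0 mulr1.
have ck j : ccont (fun t => u t * q t ^+ N * zmode j t) by apply: ccontM => //; exact: zmode_ccont.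
have -> : (fun t => u t * q t ^+ N.+1 * zmode k t) =
  fun t => (al * (u t * q t ^+ N * zmode k t) + be * (u t * q t ^+ N * zmode (1 + k) t))
    + ga * (u t * q t ^+ N * zmode (-1 + k) t).
  by apply/funext => t; rewrite !zmodeD exprSr {2}/q; ring.
rewrite circle_integralD; last 2 first.
- by apply: ccont_cintegrable; apply: ccontD; exact: ccontZ.
- by apply: ccont_cintegrable; exact: ccontZ.
rewrite circle_integralD; try (apply: ccont_cintegrable; exact: ccontZ).
by rewrite !circle_integralZ; try exact: ccont_cintegrable; rewrite !IH !mulr0 !addr0.
Qed.

(** Peak functions.  If u (t0) != 0, multiply u by a constant z for which the real part h of
z u is positive near t0.  The function phi = (1 + cos (t - t0)) / (2 - r) exceeds 1 only where h > d > 0,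
and it lies in [0, 1] elsewhere.  By Bernoulli's inequality h phi^N is then at
least N d max(phi - 1, 0) - M for every N.  Its integral vanishes, since phi^N is a
trigonometric polynomial; letting N grow forces the integral of max(phi - 1, 0) to be
zero, although this function is positive at t0. *)
Lemma fourier_uniqueness u : ccont u -> periodic u (2 * pi) ->
  (forall k, CI (fun t => u t * zmode k t) = 0) -> u = fun=> 0.
Proof.
move=> cu pu hu; apply/funext => x; apply/eqP; apply: contrapT => /negP ux.
have [k /andP[k1 k2]] := shift_to_period x 0; rewrite add0r in k2.
set t0 := x + _ in k1 k2.
have Dt0 : D t0 by rewrite /fund_dom /= in_itv /= k1.
have {}ux : u t0 != 0 by rewrite /t0 periodic_int.
have tp := twopi_gt0 R.
(* this makes Re (z u) equal to |u|^2 at t0 *)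
pose z := ((u t0)^*)%C.
pose h t := Re (z * u t).
have czu : ccont (fun t => z * u t) by exact: ccontZ.
have ch : continuous h by case: czu.
have ph : periodic h (2 * pi) by move=> t; rewrite /h pu.
have h0 : 0 < h t0.
  rewrite /h /z ReM ReJ ImJ mulNr opprK -!expr2 -normc_sqr exprn_gt0//.
  rewrite lt_neqAle normc_ge0 andbT eq_sym; apply: contra ux => /eqP e.
  by apply/eqP; exact: ComplexField.Normc.eq0_normc.
have [r /andP[r0 r2] hr] := near_maximum_cos ch ph h0.
pose phi t := (1 + cos (t - t0)) / (2 - r).
pose al : C := ((2 - r)^-1)%:C%C.
pose be : C := al / 2 * expi (- t0).
pose ga : C := al / 2 * expi t0.
have phiE t : ((phi t)%:C)%C = al + be * zmode 1 t + ga * zmode (-1) t.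
  have e1 : zmode 1 t = expi t by rewrite /zmode expr1z.
  have e2 : zmode (-1) t = expi (- t) by rewrite zmodeE mulN1r.
  have -> : al + be * zmode 1 t + ga * zmode (-1) t =
     al * (1 + (expi (t - t0) + expi (- (t - t0))) / 2).
    by rewrite e1 e2 opprB (expiD t) (expiD t0) /ga /be; move: (al) => a; field.
  have -> : expi (t - t0) + expi (- (t - t0)) = ((2 * cos (t - t0))%:C)%C.
    apply: complexP; rewrite ?ReD ?ImD /= ?cosN ?sinN ?subrr//.
    by rewrite mulr_natl mulr2n.
  rewrite /al /phi; move: ((2 - r)^-1) (cos _) => y c.
  by rewrite !rmorphM rmorphD rmorph1 rmorph_nat /=; field.
have phi0 t : 0 <= phi t.
  by apply: divr_ge0; [have := cos_geN1 (t - t0); lra|lra].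
have cphi : continuous phi.
  move=> t; apply: cvgM; last exact: cvg_cst.
  apply: cvgD; first exact: cvg_cst.
  apply: continuous_comp; last exact: continuous_cos.
  by apply: cvgB; [exact: cvg_id|exact: cvg_cst].
have Jhphi N : J (fun t => h t * phi t ^+ N) = 0.
  have := ortho_cos_power al be ga czu _ N 0.
  have hz k' : CI (fun t => z * u t * zmode k' t) = 0.
    under eq_fun do rewrite -mulrA.
    rewrite circle_integralZ ?hu ?mulr0//; apply: ccont_cintegrable.
    by apply: ccontM => //; exact: zmode_ccont.
  move=> /(_ hz) /(congr1 Re) /= <-; congr Rintegral; apply/funext => t.
  by rewrite /reF zmode0 mulr1 -phiE -rmorphXn /= ReM /= mulr0 subr0.
have [M hM] := continuous_bounded_fund_dom ch.
(* psi is the positive part of phi - 1 *)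
pose psi t := (`|phi t - 1| + (phi t - 1)) / 2.
have cpsi : continuous psi.
  have c1 : continuous (fun t => phi t - 1).
    by move=> t; apply: cvgB; [exact: cphi|exact: cvg_cst].
  move=> t; apply: cvgM; last exact: cvg_cst.
  by apply: cvgD; [apply: cvg_norm|]; exact: c1.
have psi0 t : 0 <= psi t.
  by rewrite /psi divr_ge0//; have := ler_norm (- (phi t - 1)); rewrite normrN; lra.
pose d := h t0 / 2.
have d0 : 0 < d by rewrite divr_gt0.
have key (N : nat) t : D t -> N%:R * d * psi t - M <= h t * phi t ^+ N.
  move=> Dt; have hMt := hM t Dt.
  have M0 : 0 <= M by exact: le_trans (normr_ge0 _) hMt.
  have [hc|hc] := ltP (1 - r) (cos (t - t0)).
    have hd : d <= h t by exact/ltW/hr.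
    have p1 : 1 <= phi t by rewrite /phi ler_pdivlMr; lra.
    have -> : psi t = phi t - 1 by rewrite /psi ger0_norm ?subr_ge0//; lra.
    have b := bernoulli_ineq N p1.
    apply: le_trans (_ : d * phi t ^+ N <= _); last by rewrite ler_wpM2r// exprn_ge0.
    apply: le_trans (ler_wpM2l (ltW d0) b).
    by rewrite [N%:R * d]mulrC -mulrA lerBlDr lerDl.
  have p1 : phi t <= 1 by rewrite /phi ler_pdivrMr; lra.
  have -> : psi t = 0 by rewrite /psi ler0_norm ?subr_le0//; lra.
  rewrite mulr0 add0r.
  have : `|h t * phi t ^+ N| <= M.
    rewrite normrM -[M]mulr1 ler_pM// ger0_norm ?exprn_ge0//.
    by rewrite exprn_ile1.
  by rewrite ler_norml => /andP[].
have Ipsi := continuous_rint cpsi.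
have Icst (c : R) : rint (fun=> c) by apply: continuous_rint => s; exact: cvg_cst.
have JN (N : nat) : N%:R * (d * J psi) <= M * (2 * pi).
  have Il : rint (fun t => N%:R * d * psi t - M) by apply: rintD => //; exact: rintZ.
  have Ir : rint (fun t => h t * phi t ^+ N).
    apply: continuous_rint => t; apply: cvgM; first exact: ch.
    apply: (@continuous_comp _ _ _ phi (fun x : R => x ^+ N)); first exact: cphi.
    exact: exprn_continuous.
  have : J (fun t => N%:R * d * psi t - M) <= J (fun t => h t * phi t ^+ N).
    by apply: le_Rintegral => //; [exact: measurable_fund_dom|exact: key].
  rewrite Jhphi RintegralB//; [|exact: measurable_fund_dom|exact: rintZ].
  rewrite RintegralZl//; last exact: measurable_fund_dom.
  by rewrite Rintegral_fund_dom_cst; lra.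
have Jle : J psi <= 0.
  rewrite leNgt; apply/negP => Jp.
  have dJ : 0 < d * J psi by rewrite mulr_gt0.
  have := JN (Num.truncn (M * (2 * pi) / (d * J psi))).+1.
  by rewrite -ler_pdivlMr// leNgt truncnS_gt.
have := continuous_ge0_Rintegral_eq0 cpsi (fun t _ => psi0 t) Jle Dt0.
rewrite /psi /phi subrr cos0 => e.
have : 1 < (1 + 1) / (2 - r) by rewrite ltr_pdivlMr; lra.
move: e; move: ((1 + 1) / (2 - r)) => y; have := normr_ge0 (y - 1); lra.
Qed.

End Completeness.

(** * Termwise differentiation of series *)

Section Termwise.
Variable R : realType.
Implicit Types f g h : R -> R.

Lemma MVT_between f g (x y : R) : (forall t : R, is_derive t 1 f (g t)) ->
  exists2 c, `|c - x| <= `|y - x| & f y - f x = g c * (y - x).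
Proof.
move=> df; have cf : continuous f.
  move=> t; apply: differentiable_continuous; apply/derivable1_diffP.
  by case: (df t).
have [xy|/ltW yx] := leP x y.
  have [c] := MVT_segment xy (fun t _ => df t) (continuous_subspaceT cf).
  rewrite in_itv /= => /andP[xc cy] e; exists c => //.
  by rewrite !ger0_norm ?subr_ge0// lerD2r.
have [c] := MVT_segment yx (fun t _ => df t) (continuous_subspaceT cf).
rewrite in_itv /= => /andP[yc cx] e; exists c.
  by rewrite !ler0_norm ?subr_le0// lerN2 lerD2r.
by rewrite -opprB e -mulrN opprB.
Qed.

(** The mean value theorem applied twice. *)
Lemma quadratic_remainder f g h (L x y : R) :
  (forall t : R, is_derive t 1 f (g t)) -> (forall t : R, is_derive t 1 g (h t)) ->
  (forall t, `|h t| <= L) -> `|f y - f x - g x * (y - x)| <= L * `|y - x| ^+ 2.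
Proof.
move=> df dg hL; have [c cx ->] := MVT_between x y df.
have [d dx] := MVT_between x c dg.
rewrite -mulrBl normrM => ->; rewrite expr2 mulrA ler_wpM2r//.
by rewrite normrM ler_pM.
Qed.

Lemma dist_lim_le (u : nat -> R) (l B : R) : u @ \oo --> l ->
  (forall n, `|u n| <= B) -> `|l| <= B.
Proof.
move=> ul uB; have nl : (fun n => `|u n|) @ \oo --> `|l| by exact: cvg_norm.
rewrite -(cvg_lim _ nl)//; apply: limr_le; first by apply/cvg_ex; exists `|l|.
by apply: nearW.
Qed.

(** A uniform bound on the second derivatives makes the remainders of the first-order
expansions of all the f n smaller than L (y - x)^2, an estimate that survives
pointwise limits. *)
Lemma termwise_derive (f g h : nat -> R -> R) (F G : R -> R) (L : R) :
  (forall n (t : R), is_derive t 1 (f n) (g n t)) ->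
  (forall n (t : R), is_derive t 1 (g n) (h n t)) ->
  (forall n t, `|h n t| <= L) ->
  (forall t, (fun n => f n t) @ \oo --> F t) ->
  (forall t, (fun n => g n t) @ \oo --> G t) ->
  forall t : R, is_derive t 1 F (G t).
Proof.
move=> df dg hL fF gG x.
have rem y : `|F y - F x - G x * (y - x)| <= L * `|y - x| ^+ 2.
  apply: (@dist_lim_le (fun n => f n y - f n x - g n x * (y - x))).
    apply: cvgB; first by apply: cvgB; exact: fF.
    by apply: cvgM; [exact: gG|exact: cvg_cst].
  by move=> n; exact: quadratic_remainder (df n) (dg n) (hL n).
have L0 : 0 <= L by exact: le_trans (normr_ge0 _) (hL 0%N 0).
have H : (fun s : R => s^-1 *: ((F \o shift x) (s *: (1 : R)) - F x)) @ 0^' --> G x.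
  apply/cvgrPdist_le => e e0; near=> s.
  have s0 : s != 0 by near: s; exact: nbhs_dnbhs_neq.
  have se : `|s| <= e / (L + 1).
    near: s; apply: dnbhs0_le; by rewrite divr_gt0// ltr_wpDl.
  have := rem (x + s); rewrite [x + s - x]addrAC subrr add0r => r.
  have -> : G x - s^-1 *: ((F \o shift x) (s *: (1 : R)) - F x) =
      - (s^-1 * (F (x + s) - F x - G x * s)).
    by rewrite /= /shift /GRing.scale /= mulr1 [s + x]addrC; field.
  rewrite normrN normrM normrV ?unitfE// ler_pdivrMl ?normr_gt0//.
  apply: le_trans r _.
  rewrite expr2 mulrA mulrC ler_wpM2l//.
  apply: (@le_trans _ _ ((L + 1) * `|s|)).
    by rewrite ler_wpM2r// lerDl.
  by rewrite mulrC -ler_pdivlMr// ltr_wpDl.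
split; first by apply/cvg_ex; exists (G x).
exact: cvg_lim H.
Unshelve. all: by end_near.
Qed.

(** A telescoping summable sequence: it is the natural majorant of size n^(-2). *)
Definition gap (n : nat) : R := n.+1%:R^-1 - n.+2%:R^-1.

Lemma gapE n : gap n = (n.+1%:R * n.+2%:R)^-1.
Proof.
have : 0 < n.+1%:R :> R by [].
rewrite /gap -[n.+2]addn1 natrD; move: (n.+1%:R : R) => y y0.
by field; rewrite !gt_eqF// addr_gt0.
Qed.

(** Both s_N - M/(N+1) and s_N + M/(N+1) are monotone, in opposite directions, because
gap is a difference of consecutive terms 1/(n+1).  This gives convergence and the
rate at once. *)
Lemma dominated_series (x : nat -> R) (M : R) : (forall n, `|x n| <= M * gap n) ->
  exists2 l, (fun N => \sum_(n < N) x n) @ \oo --> l &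
    forall N, `|l - \sum_(n < N) x n| <= M / N.+1%:R.
Proof.
move=> xM; pose s N := \sum_(n < N) x n.
pose y N := s N - M / N.+1%:R; pose z N := s N + M / N.+1%:R.
have xMn n : - (M * gap n) <= x n <= M * gap n by rewrite -ler_norml.
have ynd : nondecreasing_seq y.
  apply/nondecreasing_seqP => n; rewrite /y /s big_ord_recr /=.
  have /andP[h _] := xMn n; move: h; rewrite /gap.
  by move: (n.+1%:R^-1) (n.+2%:R^-1) (x n) (\sum_(i < n) _) => a b c d; lra.
have zni : nonincreasing_seq z.
  apply/nonincreasing_seqP => n; rewrite /z /s big_ord_recr /=.
  have /andP[_ h] := xMn n; move: h; rewrite /gap.
  by move: (n.+1%:R^-1) (n.+2%:R^-1) (x n) (\sum_(i < n) _) => a b c d; lra.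
have M0 : 0 <= M.
  have := le_trans (normr_ge0 _) (xM 0%N).
  by rewrite pmulr_lge0// gapE invr_gt0 mulr_gt0.
have yz n : y n <= z n.
  have : 0 <= M / n.+1%:R by rewrite divr_ge0.
  by rewrite /y /z; move: (M / _) (s n) => a b; lra.
have h0 : (fun n => M / n.+1%:R) @ \oo --> (0 : R).
  by rewrite -[X in _ --> X](mulr0 M); apply: cvgMr; exact: cvg_harmonic.
have cy : cvgn y.
  apply: nondecreasing_is_cvgn => //; exists (z 0%N) => _ [n _ <-].
  by apply: le_trans (yz n) _; apply: zni.
have sl : s @ \oo --> limn y.
  have -> : s = fun n => y n + M / n.+1%:R by apply/funext => n; rewrite /y subrK.
  by rewrite -[X in _ --> X]addr0; exact: cvgD.
have zl : z @ \oo --> limn y by rewrite -[X in _ --> X]addr0; exact: cvgD.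
exists (limn y) => // N.
have : y N <= limn y by exact: nondecreasing_cvgn_le.
have : limn y <= z N.
  rewrite -(cvg_lim _ zl)//; apply: nonincreasing_cvgn_ge => //.
  by apply/cvg_ex; exists (limn y).
rewrite /y /z -/(s N) => a b; rewrite ler_norml.
by move: (limn _) (M / _) (s N) a b => l c d a b; apply/andP; split; lra.
Qed.

End Termwise.

(** * Fourier series with rapidly decreasing coefficients *)

Section Fourier_series.
Variable R : realType.
Notation C := R[i].
Implicit Types (u v w : R -> C) (z : C) (k j : int) (a : nat -> C).

Notation Re := (@complex.Re R).
Notation Im := (@complex.Im R).
Notation normc := (@ComplexField.Normc.normc R).
Notation D := (@fund_dom R).
Notation CI := (@circle_integral R).
Notation zmode := (@zmode R).
Notation gap := (gap R).

(** Uniform convergence with the rate 1/N that [dominated_series] provides; fixing a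
rate replaces filters of functions by explicit inequalities. *)
Definition ucvg (p : nat -> R -> C) w :=
  exists M : R, forall N t, normc (w t - p N t) <= M / N.+1%:R.

Lemma ucvg_eps p w (e : R) (N0 : nat) : ucvg p w -> 0 < e ->
  exists2 N, (N0 <= N)%N & forall t, normc (w t - p N t) <= e.
Proof.
move=> [M hM] e0; pose N := (N0 + (Num.truncn (`|M| / e)).+1)%N.
exists N; first by rewrite leq_addr.
move=> t; apply: le_trans (hM N t) _; rewrite ler_pdivrMr// mulrC -ler_pdivrMr//.
apply: le_trans (_ : `|M| / e <= _); first by rewrite ler_pM2r ?invr_gt0// ler_norm.
apply: le_trans (ltW (truncnS_gt _)) _; by rewrite ler_nat /N leqW// leq_addl.
Qed.

Lemma normc_small_eq0 z : (forall e : R, 0 < e -> normc z <= e) -> z = 0.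
Proof.
move=> h; apply: ComplexField.Normc.eq0_normc; apply/eqP.
rewrite eq_le normc_ge0 andbT; apply/ler_addgt0Pl => e e0; rewrite addr0; exact: h.
Qed.

(** Used to identify a series from its partial sums. *)
Lemma ucvg_unique p w w' : ucvg p w -> ucvg p w' -> w = w'.
Proof.
move=> [M hM] [M' hM']; apply/funext => t; apply/eqP; rewrite -subr_eq0; apply/eqP.
have h : ucvg (fun _ _ => 0) (fun=> w t - w' t).
  exists (M + M') => N s; rewrite subr0 mulrDl.
  have -> : w t - w' t = (w t - p N t) + - (w' t - p N t) by ring.
  by apply: le_trans (normcD _ _) _; rewrite normcN lerD.
apply: normc_small_eq0 => e e0.
by have [N _ /(_ t)] := ucvg_eps 0 h e0; rewrite subr0.
Qed.

Lemma ucvgD p q w w' : ucvg p w -> ucvg q w' ->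
  ucvg (fun N t => p N t + q N t) (fun t => w t + w' t).
Proof.
move=> [M hM] [M' hM']; exists (M + M') => N t; rewrite mulrDl.
have -> : w t + w' t - (p N t + q N t) = (w t - p N t) + (w' t - q N t) by ring.
by apply: le_trans (normcD _ _) (lerD _ _).
Qed.

Lemma ucvgM p w (b : R -> C) (B : R) : (forall t, normc (b t) <= B) -> ucvg p w ->
  ucvg (fun N t => b t * p N t) (fun t => b t * w t).
Proof.
move=> hb [M hM]; exists (B * M) => N t; rewrite -mulrBr ComplexField.Normc.normcM.
by rewrite -mulrA ler_pM ?normc_ge0.
Qed.

Lemma ucvgZ z p w : ucvg p w -> ucvg (fun N t => z * p N t) (fun t => z * w t).
Proof. exact: ucvgM. Qed.

Lemma ucvg_sum (I : Type) (s : seq I) (p : I -> nat -> R -> C) (w : I -> R -> C) :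
  (forall i, ucvg (p i) (w i)) ->
  ucvg (fun N t => \sum_(i <- s) p i N t) (fun t => \sum_(i <- s) w i t).
Proof.
move=> h; elim: s => [|i s [M hM]].
  by exists 0 => N t; rewrite !big_nil subr0 ComplexField.Normc.normc0 mul0r.
have [M' hM'] := ucvgD (h i) (ex_intro _ M hM).
by exists M' => N t; rewrite !big_cons; exact: hM'.
Qed.

Definition rapid a := forall j : nat, exists M : R,
  forall n, normc (a n) * n%:R ^+ j <= M.

(** The bounds with exponents 0, 1 and 2 combine since (n+1)(n+2) = n^2 + 3 n + 2. *)
Lemma rapid_gap a : rapid a -> exists M, forall n, normc (a n) <= M * gap n.
Proof.
move=> ra; have [M0 h0] := ra 0%N; have [M1 h1] := ra 1%N; have [M2 h2] := ra 2%N.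
exists (M2 + 3 * M1 + 2 * M0) => n.
rewrite gapE ler_pdivlMr ?mulr_gt0//.
have := h0 n; have := h1 n; have := h2 n.
have -> : (n.+1%:R * n.+2%:R : R) = n%:R ^+ 2 + 3 * n%:R + 2.
  by rewrite -[n.+2]addn2 -[n.+1]addn1 !natrD; ring.
rewrite expr0 expr1; move: (normc _) (n%:R : R) => x y; nra.
Qed.

Lemma rapidM a z : rapid a -> rapid (fun n => z * n%:R * a n).
Proof.
move=> ra j; have [M hM] := ra j.+1; exists (normc z * M) => n.
rewrite !ComplexField.Normc.normcM.
have -> : normc (n%:R : C) = n%:R by rewrite -(rmorph_nat (real_complex R)) normcR ger0_norm.
have -> : normc z * n%:R * normc (a n) * n%:R ^+ j =
  normc z * (normc (a n) * n%:R ^+ j.+1) by rewrite exprS; ring.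
by rewrite ler_wpM2l// normc_ge0.
Qed.

Definition hardy_psum a (N : nat) : R -> C := fun t => \sum_(n < N) a n * zmode n t.

Definition climn (x : nat -> C) : C :=
  Complex (limn (fun N => Re (x N))) (limn (fun N => Im (x N))).

Definition hardy_series a : R -> C := fun t => climn (fun N => hardy_psum a N t).

Lemma Re_sum (I : Type) (s : seq I) (F : I -> C) :
  Re (\sum_(i <- s) F i) = \sum_(i <- s) Re (F i).
Proof. by elim/big_rec2: _ => // i x y _ <-; rewrite ReD. Qed.
Lemma Im_sum (I : Type) (s : seq I) (F : I -> C) :
  Im (\sum_(i <- s) F i) = \sum_(i <- s) Im (F i).
Proof. by elim/big_rec2: _ => // i x y _ <-; rewrite ImD. Qed.

Lemma hardy_series_cvg a : rapid a -> exists M : R, forall t,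
  [/\ (fun N => reF (hardy_psum a N) t) @ \oo --> reF (hardy_series a) t,
      (fun N => imF (hardy_psum a N) t) @ \oo --> imF (hardy_series a) t &
      forall N, normc (hardy_series a t - hardy_psum a N t) <= M / N.+1%:R].
Proof.
move=> /rapid_gap[M hM]; exists (2 * M) => t.
have h n : normc (a n * zmode n t) <= M * gap n.
  by rewrite ComplexField.Normc.normcM normc_zmode mulr1.
have [l hl hl'] := dominated_series (fun n => le_trans (Re_le_normc _) (h n)).
have [m hm hm'] := dominated_series (fun n => le_trans (Im_le_normc _) (h n)).
have reE : (fun N => reF (hardy_psum a N) t) = (fun N => \sum_(n < N) Re (a n * zmode n t)).
  by apply/funext => N; rewrite /reF Re_sum.
have imE : (fun N => imF (hardy_psum a N) t) = (fun N => \sum_(n < N) Im (a n * zmode n t)).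
  by apply/funext => N; rewrite /imF Im_sum.
have lE : reF (hardy_series a) t = l.
  by rewrite /reF /hardy_series /= -/(reF _ _) reE (cvg_lim _ hl).
have mE : imF (hardy_series a) t = m.
  by rewrite /imF /hardy_series /= -/(imF _ _) imE (cvg_lim _ hm).
rewrite lE mE reE imE; split => // N.
apply: le_trans (normc_le_ReIm _) _.
rewrite ReD ImD ReN ImN -!/(reF _ _) -!/(imF _ _) lE mE.
have -> : reF (hardy_psum a N) t = \sum_(n < N) Re (a n * zmode n t) by rewrite /reF Re_sum.
have -> : imF (hardy_psum a N) t = \sum_(n < N) Im (a n * zmode n t) by rewrite /imF Im_sum.
by have := lerD (hl' N) (hm' N); rewrite mulr_natl mulr2n mulrDl.
Qed.

Lemma hardy_series_ucvg a : rapid a -> ucvg (hardy_psum a) (hardy_series a).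
Proof. by move=> /hardy_series_cvg[M h]; exists M => N t; case: (h t). Qed.

(** The bound does not depend on N, because the gaps add up to less than 1. *)
Lemma hardy_psum_bound a (M : R) N t : (forall n, normc (a n) <= M * gap n) ->
  normc (hardy_psum a N t) <= M.
Proof.
move=> h; apply: le_trans (normc_sum _ _) _.
apply: (@le_trans _ _ (\sum_(n < N) M * gap n)).
  by apply: ler_sum => n _; rewrite ComplexField.Normc.normcM normc_zmode mulr1.
rewrite -mulr_sumr.
have -> : \sum_(i < N) gap i = 1 - N.+1%:R^-1.
  elim: N => [|N IH]; first by rewrite big_ord0 invr1 subrr.
  by rewrite big_ord_recr /= IH /gap addrA subrK.
have M0 : 0 <= M.
  have := le_trans (normc_ge0 _) (h 0%N).
  by rewrite pmulr_lge0// gapE invr_gt0 mulr_gt0.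
by rewrite mulrBr mulr1 gerBl mulr_ge0// invr_ge0.
Qed.

Lemma hardy_psum_has_cderive a N :
  has_cderive (hardy_psum a N) (hardy_psum (fun n => 'i%C * n%:R * a n) N).
Proof.
have h (n : 'I_N) := has_cderiveZ (a n) (zmode_has_cderive n).
apply: eq_has_cderive (has_cderive_sum _ h) _ => t.
by apply: eq_bigr => n _; rewrite -pmulrn; ring.
Qed.

(** The second derivatives of the partial sums are uniformly bounded because the
coefficients i n i n a_n are still rapidly decreasing. *)
Lemma hardy_series_has_cderive a : rapid a ->
  has_cderive (hardy_series a) (hardy_series (fun n => 'i%C * n%:R * a n)).
Proof.
move=> ra; have ra1 := rapidM 'i%C ra; have ra2 := rapidM 'i%C ra1.
have [M hM] := rapid_gap ra2.
have [M0 h0] := hardy_series_cvg ra; have [M1 h1] := hardy_series_cvg ra1.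
move=> t; split.
- apply: (@termwise_derive R (fun N => reF (hardy_psum a N)) _ _ _ _ M
    (fun N s => (hardy_psum_has_cderive a N s).1) (fun N s => (hardy_psum_has_cderive _ N s).1)).
  + by move=> N s; apply: le_trans (Re_le_normc _) (hardy_psum_bound _ _ hM).
  + by move=> s; case: (h0 s).
  + by move=> s; case: (h1 s).
- apply: (@termwise_derive R (fun N => imF (hardy_psum a N)) _ _ _ _ M
    (fun N s => (hardy_psum_has_cderive a N s).2) (fun N s => (hardy_psum_has_cderive _ N s).2)).
  + by move=> N s; apply: le_trans (Im_le_normc _) (hardy_psum_bound _ _ hM).
  + by move=> s; case: (h0 s).
  + by move=> s; case: (h1 s).
Qed.

Lemma hardy_psum_periodic a N : periodic (hardy_psum a N) (2 * pi).
Proof. by move=> t; apply: eq_bigr => n _; rewrite zmode_periodic. Qed.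

Lemma hardy_series_periodic a : periodic (hardy_series a) (2 * pi).
Proof.
move=> t; apply: (congr1 climn).
by apply/funext => N; exact: hardy_psum_periodic.
Qed.

Definition csmooth u := smooth_fun (reF u) /\ smooth_fun (imF u).

(** Coinductive smoothness: a class of differentiable functions that is stable under
differentiation consists of smooth functions. *)
Lemma has_cderive_csmooth (P : (R -> C) -> Prop) :
  (forall u, P u -> exists2 du, has_cderive u du & P du) -> forall u, P u -> csmooth u.
Proof.
move=> h u Pu.
have key n : exists2 v, P v & derive1n n (reF u) = reF v /\ derive1n n (imF u) = imF v.
  elim: n => [|n [v Pv [rv iv]]]; first by exists u.
  have [dv hdv Pdv] := h v Pv; exists dv => //; rewrite !derive1nS rv iv.
  by split; apply/funext => t; rewrite derive1E; case: (hdv t) => h1 h2; rewrite derive_val.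
split=> n t; have [v Pv [rv iv]] := key n; have [dv hdv _] := h v Pv; case: (hdv t) => h1 h2.
  by rewrite rv; case: h1.
by rewrite iv; case: h2.
Qed.

Lemma csmooth_has_cderive u : csmooth u -> has_cderive u (cderive u) /\ csmooth (cderive u).
Proof.
move=> [sr si]; split.
  by move=> t; split; rewrite /reF /imF /= derive1E; apply/derivableP;
    [exact: (sr 0%N)|exact: (si 0%N)].
split=> n t.
  have -> : reF (cderive u) = derive1 (reF u) by apply/funext.
  by rewrite -derive1Sn; exact: sr.
have -> : imF (cderive u) = derive1 (imF u) by apply/funext.
by rewrite -derive1Sn; exact: si.
Qed.

Lemma csmoothZ z u : csmooth u -> csmooth (fun t => z * u t).
Proof.
move=> su; apply: (@has_cderive_csmooth (fun w => exists2 v, csmooth v & w = fun t => z * v t)).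
  move=> _ [v sv ->]; have [hv sv'] := csmooth_has_cderive sv.
  by exists (fun t => z * cderive v t); [exact: has_cderiveZ|exists (cderive v)].
by exists u.
Qed.

Lemma zmode_smooth k z : circle_smooth (fun t => z * zmode k t).
Proof.
split; first by move=> t; rewrite zmode_periodic.
apply: (@has_cderive_csmooth (fun w => exists z', w = fun t => z' * zmode k t)); last by exists z.
move=> _ [z' ->]; exists (fun t => z' * ('i%C * k%:~R * zmode k t)).
  exact: has_cderiveZ (zmode_has_cderive k).
by exists (z' * ('i%C * k%:~R)); apply/funext => t; rewrite !mulrA.
Qed.

Lemma hardy_series_smooth a : rapid a -> circle_smooth (hardy_series a).
Proof.
move=> ra; split; first exact: hardy_series_periodic.
apply: (@has_cderive_csmooth (fun w => exists2 b, rapid b & w = hardy_series b)); last by exists a.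
move=> _ [b rb ->]; exists (hardy_series (fun n => 'i%C * n%:R * b n)).
  exact: hardy_series_has_cderive.
by exists (fun n => 'i%C * n%:R * b n) => //; exact: rapidM.
Qed.

Lemma cderive_periodic u c : periodic u c -> periodic (cderive u) c.
Proof.
have h (f : R -> R) : periodic f c -> periodic (derive1 f) c.
  move=> pf t; rewrite /derive1.
  rewrite (_ : (fun h => _) = (fun h => h^-1 *: (f (h + t) - f t)))//.
  by apply/funext => s; rewrite addrA !pf.
move=> pu t; rewrite /cderive !h//.
  by move=> s; rewrite /imF pu.
by move=> s; rewrite /reF pu.
Qed.

Lemma Dtheta_smooth u : circle_smooth u -> circle_smooth (Dtheta u).
Proof.
move=> [pu su]; split; last exact/csmoothZ/(csmooth_has_cderive su).2.
by move=> t; rewrite /Dtheta cderive_periodic.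
Qed.

Lemma iter_Dtheta_smooth r u : circle_smooth u -> circle_smooth (iter r (@Dtheta R) u).
Proof. by move=> su; elim: r => [//|r IH]; rewrite iterS; apply: Dtheta_smooth. Qed.

Lemma circle_smooth_ccont u : circle_smooth u -> ccont u.
Proof. by move=> [_ su]; exact: has_cderive_ccont (csmooth_has_cderive su).1. Qed.

Lemma Dtheta_has_cderive u du : has_cderive u du -> Dtheta u = fun t => ('i%C)^-1 * du t.
Proof. by move=> h; rewrite /Dtheta (cderiveE h). Qed.

Lemma iter_Dtheta_zmode r k z :
  iter r (@Dtheta R) (fun t => z * zmode k t) = fun t => z * k%:~R ^+ r * zmode k t.
Proof.
elim: r => [|r IH]; first by apply/funext => t; rewrite expr0 mulr1.
rewrite iterS IH (Dtheta_has_cderive (has_cderiveZ _ (zmode_has_cderive k))); apply/funext => t.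
by rewrite exprS; field; exact: imaginary_neq0.
Qed.

Lemma iter_Dtheta_hardy_series r a : rapid a ->
  rapid (fun n => n%:R ^+ r * a n) /\
  iter r (@Dtheta R) (hardy_series a) = hardy_series (fun n => n%:R ^+ r * a n).
Proof.
move=> ra; elim: r => [|r [rr IH]].
  have -> : (fun n => n%:R ^+ 0 * a n) = a by apply/funext => n; rewrite mul1r.
  by [].
have E : (fun n => n%:R ^+ r.+1 * a n) = fun n => 1 * n%:R * (n%:R ^+ r * a n).
  by apply/funext => n; rewrite exprS mul1r mulrA.
have rr1 := rapidM 1 rr; rewrite E; split => //.
rewrite iterS IH (Dtheta_has_cderive (hardy_series_has_cderive rr)).
apply: ucvg_unique (ucvgZ _ (hardy_series_ucvg (rapidM 'i%C rr))) _.
have [M hM] := hardy_series_ucvg rr1; exists M => N t; have := hM N t; congr (normc (_ - _) <= _).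
rewrite mulr_sumr; apply: eq_bigr => n _; field; exact: imaginary_neq0.
Qed.

(** Integration by parts: D is symmetric and has the mode e_j as eigenvector with
eigenvalue j. *)
Lemma circle_integral_iter_Dtheta r u j : circle_smooth u ->
  CI (fun t => iter r (@Dtheta R) u t * zmode (- j) t) =
  j%:~R ^+ r * CI (fun t => u t * zmode (- j) t).
Proof.
move=> su; elim: r => [|r IH]; first by rewrite expr0 mul1r.
rewrite exprS -mulrA -IH iterS; set v := iter r _ u.
have sv : circle_smooth v by exact: iter_Dtheta_smooth.
have [hv sv'] := csmooth_has_cderive sv.2.
have cv := circle_smooth_ccont sv; have ce := zmode_ccont R (- j).
have cdv : ccont (cderive v) by exact: has_cderive_ccont (csmooth_has_cderive sv').1.
have e1 := ccont_cintegrable (ccontM cdv ce); have e2 := ccont_cintegrable (ccontM cv ce).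
have h := has_cderiveM hv (zmode_has_cderive (- j)).
have := circle_integral_derivative h.
rewrite circle_integralD//; last exact/ccont_cintegrable/ccontM/ccontZ.
have -> : (fun t => v t * ('i%C * (- j)%:~R * zmode (- j) t)) =
  fun t => 'i%C * (- j)%:~R * (v t * zmode (- j) t) by apply/funext => t; ring.
rewrite circle_integralZ// => e.
have -> : (fun t => Dtheta v t * zmode (- j) t) =
  fun t => ('i%C)^-1 * (cderive v t * zmode (- j) t).
  by apply/funext => t; rewrite /Dtheta mulrA.
rewrite circle_integralZ//.
have {}e : CI (fun t => cderive v t * zmode (- j) t) =
    'i%C * j%:~R * CI (fun t => v t * zmode (- j) t).
  apply/eqP; rewrite -subr_eq0; apply/eqP; rewrite -[RHS]e.
  - by rewrite mulrNz mulrN mulNr.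
  - by apply: ccontD; apply: ccontM => //; exact: ccontZ.
  - by move=> t; rewrite sv.1 zmode_periodic.
by rewrite e !mulrA mulVf ?imaginary_neq0// mul1r.
Qed.

Definition fourier_coef u k : C := CI (fun t => u t * zmode (- k) t) / (2 * pi)%:C%C.

Lemma twopiC_neq0 : ((2 * pi : R)%:C)%C != 0 :> C.
Proof. by rewrite eq_complex /= gt_eqF// twopi_gt0. Qed.

(** n^j u^(n) is the n-th Fourier coefficient of D^j u, which is bounded. *)
Lemma fourier_coef_rapid u : circle_smooth u -> rapid (fun n => fourier_coef u n).
Proof.
move=> su j; have sj := iter_Dtheta_smooth j su.
have [cr ci] := circle_smooth_ccont sj.
have [Mr hr] := continuous_bounded_fund_dom cr; have [Mi hi] := continuous_bounded_fund_dom ci.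
exists (4 * pi * (Mr + Mi) / (2 * pi)) => n.
have -> : normc (fourier_coef u n) * n%:R ^+ j =
    normc (CI (fun t => iter j (@Dtheta R) u t * zmode (- n%:Z) t)) / (2 * pi).
  rewrite circle_integral_iter_Dtheta// /fourier_coef !ComplexField.Normc.normcM ComplexField.Normc.normcV.
  rewrite normcR ger0_norm ?(ltW (twopi_gt0 R))//.
  have -> : normc (n%:~R ^+ j : C) = n%:R ^+ j.
    have -> : (n%:~R ^+ j : C) = ((n%:R ^+ j)%:C)%C by rewrite rmorphXn rmorph_nat.
    by rewrite normcR ger0_norm// exprn_ge0.
  by rewrite mulrAC [n%:R ^+ j * _]mulrC.
rewrite ler_pM2r ?invr_gt0 ?twopi_gt0//; apply: circle_integral_bound.
  by apply: ccont_cintegrable; apply: ccontM; [exact: circle_smooth_ccont|exact: zmode_ccont].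
move=> t Dt; rewrite ComplexField.Normc.normcM normc_zmode mulr1.
by apply: le_trans (normc_le_ReIm _) _; apply: lerD; [exact: hr|exact: hi].
Qed.

Lemma hardy_series_ccont a : rapid a -> ccont (hardy_series a).
Proof. by move=> ra; exact: circle_smooth_ccont (hardy_series_smooth ra). Qed.

(** The integral can be taken term by term since the partial sums converge uniformly;
the partial sums of length greater than |k| have the right coefficient already. *)
Lemma fourier_coef_hardy_series a k : rapid a ->
  fourier_coef (hardy_series a) k = if k is Posz n then a n else 0.
Proof.
move=> ra; set b := (X in _ = X).
suff : CI (fun t => hardy_series a t * zmode (- k) t) - (2 * pi)%:C%C * b = 0.
  by move/subr0_eq; rewrite /fourier_coef => ->; rewrite mulrC mulKf// twopiC_neq0.
apply: normc_small_eq0 => e e0.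
have pi4 : 0 < 4 * pi :> R by rewrite mulr_gt0// pi_gt0.
have e4 : 0 < e / (4 * pi) by rewrite divr_gt0.
have [N kN hN] := ucvg_eps `|k|.+1 (hardy_series_ucvg ra) e4.
have cp : ccont (hardy_psum a N) by apply: ccont_sum => n; exact/ccontZ/zmode_ccont.
have cs := hardy_series_ccont ra; have ce := zmode_ccont R (- k).
have <- : CI (fun t => hardy_psum a N t * zmode (- k) t) = (2 * pi)%:C%C * b.
  have -> : (fun t => hardy_psum a N t * zmode (- k) t) =
      fun t => \sum_(n < N) a n * zmode (n%:Z - k) t.
    by apply/funext => t; rewrite mulr_suml; apply: eq_bigr => n _; rewrite zmodeD mulrA.
  rewrite circle_integral_sum; last by move=> n; exact/ccontZ/zmode_ccont.
  have czm j := ccont_cintegrable (zmode_ccont R j).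
  under eq_bigr => n _ do
    rewrite (circle_integralZ _ (czm _)) circle_integral_zmode subr_eq0.
  rewrite /b; case: k kN {hN ce b} => m mN.
    rewrite (bigD1 (Ordinal mN)) //= eqxx big1 ?addr0 1?mulrC// => n.
    by rewrite -val_eqE /= => /negPf; rewrite -eqz_nat => ->; rewrite mulr0.
  by rewrite mulr0 big1// => n _; rewrite mulr0.
rewrite -circle_integralB; try exact/ccont_cintegrable/ccontM.
have -> : e = 4 * pi * (e / (4 * pi)) by rewrite mulrC divfK// gt_eqF.
apply: circle_integral_bound; first by apply: ccont_cintegrable; apply: ccontB; exact: ccontM.
by move=> t _; rewrite -mulrBl ComplexField.Normc.normcM normc_zmode mulr1.
Qed.

End Fourier_series.

(** * Differential operators commuting with the projector *)

Section Operators.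
Variable R : realType.
Notation C := R[i].
Implicit Types (u v w : R -> C) (z : C) (k j : int) (a : nat -> C) (P : diffop R).

Notation Re := (@complex.Re R).
Notation Im := (@complex.Im R).
Notation normc := (@ComplexField.Normc.normc R).
Notation mu := (@lebesgue_measure R).
Notation D := (@fund_dom R).
Notation J f := (Rintegral mu D f).
Notation CI := (@circle_integral R).
Notation zmode := (@zmode R).
Notation span := (@lin_span C _ (range (@fourier_mode R))).

Lemma L2innerJ u v : ccont u -> ccont v -> L2inner u v = ((L2inner v u)^*)%C.
Proof.
move=> cu cv; have [ir ii] := ccont_cintegrable (ccontM cv (ccontJ cu)).
apply: complexP; rewrite ?ReJ ?ImJ /=.
  by congr Rintegral; apply/funext => t; rewrite /reF !ReM !ReJ !ImJ; ring.
have -> : imF (fun t => u t * (v t)^*%C) = fun t => -1 * imF (fun t => v t * (u t)^*%C) t.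
  by apply/funext => t; rewrite /imF !ImM !ReJ !ImJ; ring.
by rewrite RintegralZl ?mulN1r//; exact: measurable_fund_dom.
Qed.

Lemma L2inner_zmode u k : L2inner u (zmode k) = CI (fun t => u t * zmode (- k) t).
Proof. by congr circle_integral; apply/funext => t; rewrite zmodeJ. Qed.

Lemma L2innerBl u v w : ccont u -> ccont v -> ccont w ->
  L2inner (u - v) w = L2inner u w - L2inner v w.
Proof.
move=> cu cv cw; rewrite /L2inner -circle_integralB; try exact/ccont_cintegrable/ccontM/ccontJ.
by congr circle_integral; apply/funext => t; rewrite -mulrBl.
Qed.

Lemma L2innerBr u v w : ccont u -> ccont v -> ccont w ->
  L2inner u (v - w) = L2inner u v - L2inner u w.
Proof.
move=> cu cv cw; rewrite /L2inner -circle_integralB; try exact/ccont_cintegrable/ccontM/ccontJ.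
by congr circle_integral; apply/funext => t; rewrite -mulrBr -rmorphB.
Qed.

Lemma L2inner_eq0 u : ccont u -> periodic u (2 * pi) -> L2inner u u = 0 -> u = fun=> 0.
Proof.
move=> cu pu /(congr1 Re) /= h.
have h0 : J (sqmod u) = 0.
  rewrite -[RHS]h; congr Rintegral; apply/funext => t.
  by rewrite /reF ReM ReJ ImJ mulrN opprK.
have cs : continuous (sqmod u).
  by move=> t; apply: cvgD; apply: cvgM; first [exact: cu.1|exact: cu.2].
apply/funext => x; have [k hk] := shift_to_period x 0; rewrite add0r in hk.
rewrite -(periodic_int k x pu); apply: ComplexField.Normc.eq0_normc.
have s0 t : D t -> 0 <= sqmod u t by rewrite addr_ge0 ?sqr_ge0.
have Js : J (sqmod u) <= 0 by rewrite h0.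
have := continuous_ge0_Rintegral_eq0 cs s0 Js hk.
by rewrite sqmodE => /eqP; rewrite sqrf_eq0 => /eqP.
Qed.

(** The integers n for which multiplication by the mode e_k takes e_n across the
boundary between negative and nonnegative frequencies, as an explicit list so
that their number can be read off. *)
Definition crossings k : seq int :=
  if k is Negz m then [seq i%:Z | i <- iota 0 m.+1]
  else [seq Negz i | i <- iota 0 `|k|].

Lemma crossingsP n k : n \in crossings k = ((0 <= n) != (0 <= n + k)).
Proof.
case: k => m; apply/mapP/idP.
- by move=> [l]; rewrite mem_iota /= => lm ->; lia.
- move=> h; exists (`|n|.-1)%N; last by lia.
  by rewrite mem_iota /=; lia.
- by move=> [l]; rewrite mem_iota /= => lm ->; lia.
- move=> h; exists (`|n|)%N; last by lia.
  by rewrite mem_iota /=; lia.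
Qed.

Lemma size_crossings k : size (crossings k) = `|k|%N.
Proof. by case: k => m; rewrite size_map size_iota. Qed.

Lemma uniq_crossings k : uniq (crossings k).
Proof. by case: k => m; rewrite map_inj_uniq ?iota_uniq// => i j []. Qed.

Lemma dapply_zmode P n t : dapply P (zmode n) t =
  \sum_(r < (dorder P).+1) n%:~R ^+ r * (dcoef r t * zmode n t).
Proof.
apply: eq_bigr => r _.
have -> : zmode n = fun t => 1 * zmode n t by apply/funext => s; rewrite mul1r.
by rewrite iter_Dtheta_zmode !mul1r mulrCA.
Qed.

Lemma dapply0 P : dapply P (fun=> 0) = fun=> 0.
Proof.
apply/funext => t; apply: big1 => r _.
have -> : (fun=> 0) = fun t => 0 * zmode 0 t by apply/funext => s; rewrite mul0r.
by rewrite iter_Dtheta_zmode !mul0r mulr0.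
Qed.

Lemma dapply_ccont P u : circle_smooth u -> ccont (dapply P u).
Proof.
move=> su; apply: ccont_sum => r; apply: ccontM; apply: circle_smooth_ccont.
  exact: dcoef_smooth.
exact: iter_Dtheta_smooth.
Qed.

Lemma dapply_periodic P u : circle_smooth u -> periodic (dapply P u) (2 * pi).
Proof.
move=> su t; apply: eq_bigr => r _.
by rewrite (dcoef_smooth r).1 (iter_Dtheta_smooth r su).1.
Qed.

Lemma dapply_L2 P u : circle_smooth u -> circle_L2 (dapply P u).
Proof.
by move=> su; apply: csquare_int_circle_L2; [exact/ccont_csquare_int/dapply_ccont|exact: dapply_periodic].
Qed.

(** The difference of e_n and v lies in the Hardy space and is orthogonal to it.  It
vanishes everywhere, not only almost everywhere, because it is continuous. *)
Lemma szego_zmode_nneg (n : nat) v : circle_smooth v -> szego (zmode n) v -> v = zmode n.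
Proof.
move=> sv [_ hv ho]; have cv := circle_smooth_ccont sv; have ce := zmode_ccont R n.
have cd : ccont (zmode n - v) by exact: ccontB.
have : zmode n - v = fun=> 0.
  apply: L2inner_eq0 => //; first by move=> t; rewrite /= !fctE zmode_periodic sv.1.
  by rewrite L2innerBr// (ho v hv) (ho _ (zmode_hardy _ n)) subr0.
by move=> e; apply/funext => t; have /(congr1 (@^~ t)) := e; move/subr0_eq.
Qed.

(** e_n is orthogonal to the Hardy space for negative n, hence so is v, which belongs to it. *)
Lemma szego_zmode_neg (n : nat) v : circle_smooth v -> szego (zmode (Negz n)) v ->
  v = fun=> 0.
Proof.
move=> sv [_ hv ho]; have cv := circle_smooth_ccont sv; have ce := zmode_ccont R (Negz n).
apply: L2inner_eq0 => //; first exact: sv.1.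
have := ho v hv; rewrite L2innerBl// (hardy_ortho ce _ hv) ?sub0r.
  by move/eqP; rewrite oppr_eq0 => /eqP.
move=> m; rewrite L2inner_zmode.
have -> : (fun t => zmode (Negz n) t * zmode (- m%:Z) t) = zmode (Negz n - m%:Z).
  by apply/funext => t; rewrite zmodeD.
by rewrite circle_integral_zmode; case: eqP => //; lia.
Qed.

(** P maps e_n into the Hardy space for n >= 0 and into its orthogonal complement for
n < 0, by the preceding description of the projections of the modes. *)
Lemma commuting_matrix_coef P n m : commutes_with_szego P ->
  (0 <= n) != (0 <= m) -> L2inner (dapply P (zmode n)) (zmode m) = 0.
Proof.
move=> hP; have se : circle_smooth (zmode n).
  by have := zmode_smooth n (1 : C); under eq_fun do rewrite mul1r.
have [v [sv szv]] := hP _ se.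
have cPe := dapply_ccont P se.
case: n se szv cPe => n se szv cPe.
  rewrite (szego_zmode_nneg sv szv); case: m => // m [_ hPv _] _.
  rewrite L2innerJ//; last exact: zmode_ccont.
  rewrite hardy_ortho ?rmorph0//; first exact: zmode_ccont.
  move=> l; rewrite L2inner_zmode.
  have -> : (fun t => zmode (Negz m) t * zmode (- l%:Z) t) = zmode (Negz m - l%:Z).
    by apply/funext => t; rewrite zmodeD.
  by rewrite circle_integral_zmode; case: eqP => //; lia.
rewrite (szego_zmode_neg sv szv) dapply0; case: m => // m [_ _ ho] _.
have := ho _ (zmode_hardy R m).
rewrite L2innerBl//; [|exact: ccont_cst|exact: zmode_ccont].
have -> : L2inner (fun=> 0) (zmode m) = 0.
  by rewrite /L2inner; under eq_fun do rewrite mul0r; exact: circle_integral0.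
by rewrite subr0.
Qed.

(** The polynomial whose coefficients are the k-th Fourier coefficients of the f_r gives
the matrix coefficients of P from e_n to e_(n+k).  It vanishes on the |k| crossings
and its degree is at most the order of P. *)
Lemma coef_fourier_eq0 P k (r : 'I_(dorder P).+1) :
  commutes_with_szego P -> (dorder P < `|k|)%N ->
  CI (fun t => @dcoef R P r t * zmode (- k) t) = 0.
Proof.
move=> hP dk.
pose c r := CI (fun t => @dcoef R P r t * zmode (- k) t).
pose p := \poly_(i < (dorder P).+1) c (inord i).
have ck r' : ccont (fun t => @dcoef R P r' t * zmode (- k) t).
  by apply: ccontM; [exact/circle_smooth_ccont/dcoef_smooth|exact: zmode_ccont].
have root_p n : n \in crossings k -> p.[n%:~R] = 0.
  rewrite crossingsP => /(commuting_matrix_coef hP) <-.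
  rewrite L2inner_zmode horner_poly.
  have -> : (fun t => dapply P (zmode n) t * zmode (- (n + k)) t) = fun t =>
      \sum_(i < (dorder P).+1) n%:~R ^+ i * (dcoef i t * zmode (- k) t).
    apply/funext => t; rewrite dapply_zmode mulr_suml; apply: eq_bigr => i _.
    rewrite -!mulrA -zmodeD; congr (_ * (_ * zmode _ _)); ring.
  rewrite circle_integral_sum; last by move=> i; exact/ccontZ/ck.
  by apply: eq_bigr => i _; rewrite circle_integralZ ?inord_val 1?mulrC//; exact/ccont_cintegrable/ck.
have p0 : p = 0.
  apply/eqP; apply: contraTT (leqnn (size p)) => p_neq0; rewrite -ltnNge.
  have : (size p <= (dorder P).+1)%N by exact: size_poly.
  move=> /leq_trans/(_ dk)/leq_ltn_trans; apply.
  rewrite -size_crossings -(size_map (fun n : int => n%:~R : C)).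
  apply: max_poly_roots => //.
    by apply/allP => _ /mapP[n nk ->]; apply/rootP/root_p.
  by rewrite map_inj_uniq ?uniq_crossings//; exact: intr_inj.
have := congr1 (fun q : {poly C} => q`_r) p0.
by rewrite coef_poly ltn_ord inord_val coef0.
Qed.

(** The sum runs over the frequencies from - d to d, shifted by d to be indexed by an
ordinal. *)
Lemma leading_coef_trig P : commutes_with_szego P ->
  exists c : 'I_(dorder P).*2.+1 -> C, forall t,
  dcoef (@ord_max (dorder P)) t =
    \sum_(i < (dorder P).*2.+1) c i * zmode (i%:Z - (dorder P)%:Z) t.
Proof.
move=> hP; set d := dorder P; set f := dcoef _.
have [pf sf] : circle_smooth f by exact: dcoef_smooth.
have cf : ccont f by apply: circle_smooth_ccont.
pose c (i : 'I_d.*2.+1) := fourier_coef f (i%:Z - d%:Z); exists c.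
pose g t := \sum_(i < d.*2.+1) c i * zmode (i%:Z - d%:Z) t.
have cg : ccont g by apply: ccont_sum => i; exact/ccontZ/zmode_ccont.
suff : (fun t => f t - g t) = fun=> 0.
  by move=> e t; have /(congr1 (@^~ t)) := e; move/subr0_eq.
apply: fourier_uniqueness; first exact: ccontB.
  have pg : periodic g (2 * pi).
    by move=> t; apply: eq_bigr => i _; rewrite zmode_periodic.
  by move=> t; rewrite pf pg.
move=> j.
have -> : (fun t => (f t - g t) * zmode j t) = fun t => f t * zmode j t - g t * zmode j t.
  by apply/funext => t; rewrite mulrBl.
have ce := zmode_ccont R j.
rewrite circle_integralB; try exact/ccont_cintegrable/ccontM.
have -> : (fun t => g t * zmode j t) = fun t =>
    \sum_(i < d.*2.+1) c i * zmode (i%:Z - d%:Z + j) t.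
  by apply/funext => t; rewrite mulr_suml; apply: eq_bigr => i _; rewrite [in RHS]zmodeD mulrA.
rewrite circle_integral_sum; last by move=> i; exact/ccontZ/zmode_ccont.
have czm l := ccont_cintegrable (zmode_ccont R l).
under eq_bigr => i _ do rewrite (circle_integralZ _ (czm _)) circle_integral_zmode.
have [jd|jd] := leqP `|j| d.
  have h : (`|d%:Z - j| < d.*2.+1)%N by lia.
  have hv : (Ordinal h : nat)%:Z = d%:Z - j by rewrite /=; lia.
  rewrite (bigD1 (Ordinal h)) //= [X in _ - (_ + X)]big1 ?addr0.
    have -> : (`|d%:Z - j|%N%:Z - d%:Z + j == 0) = true by lia.
    rewrite /c /fourier_coef hv (_ : - (d%:Z - j - d%:Z) = j); last by lia.
    by rewrite divfK ?subrr// twopiC_neq0.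
  move=> i; rewrite -val_eqE /= => hi.
  by rewrite ifF ?mulr0//; apply/negbTE; lia.
rewrite big1 ?subr0 => [|i _].
  by have := @coef_fourier_eq0 P (- j) ord_max hP; rewrite opprK; apply; lia.
have hi := ltn_ord i.
by rewrite ifF ?mulr0//; apply/negbTE; lia.
Qed.

(** The Hardy space is closed under uniform limits of elements of the span. *)
Lemma hardy_ucvg p w : ccont w -> periodic w (2 * pi) -> (forall N, span (p N)) ->
  ucvg p w -> hardy w.
Proof.
move=> cw pw sp uc; apply: hardy_unif => // e e0.
by have [N _ hN] := ucvg_eps 0 uc e0; exists (p N).
Qed.

Lemma L2inner_fourier_coef u k : L2inner u (zmode k) = fourier_coef u k * ((2 * pi)%:C)%C.
Proof. by rewrite L2inner_zmode divfK// twopiC_neq0. Qed.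

(** The projection of a smooth function drops the negative frequencies from its
Fourier series; the difference is orthogonal to the Hardy space because its
coefficients of nonnegative index vanish. *)
Lemma szego_hardy_series u : circle_smooth u ->
  szego u (hardy_series (fun n => fourier_coef u n)).
Proof.
move=> su; have ra := fourier_coef_rapid su.
have cu := circle_smooth_ccont su; have cs := hardy_series_ccont ra.
split.
- by apply: csquare_int_circle_L2; [exact: ccont_csquare_int|exact: su.1].
- apply: (hardy_ucvg cs (@hardy_series_periodic _ _) _ (hardy_series_ucvg ra)) => N.
  exact: (span_sum (fun i : 'I_N => fourier_coef u i) (fun i => i : nat)).
- move=> w; apply: hardy_ortho; first exact: ccontB.
  move=> n; rewrite L2innerBl//; last exact: zmode_ccont.
  by rewrite !L2inner_fourier_coef fourier_coef_hardy_series// subrr.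
Qed.

Section Monomial_operator.
Variables (d : nat) (k : int) (q : {poly C}).
Hypotheses (size_q : (size q <= d.+1)%N).
Hypothesis root_q : forall n, n \in crossings k -> q.[n%:~R] = 0.

(** The operator e_k q(D). *)
Definition mono_op : diffop R :=
  @Diffop R d (fun r t => q`_r * zmode k t) (fun r => zmode_smooth k q`_r).

Lemma mono_op_apply u t : dapply mono_op u t =
  zmode k t * \sum_(r < d.+1) q`_r * iter r (@Dtheta R) u t.
Proof. by rewrite mulr_sumr; apply: eq_bigr => r _ /=; rewrite -mulrA mulrCA. Qed.

(** The operator maps e_n to q(n) e_(n+k); a term of negative frequency n + k with
n >= 0 is killed by the factor q(n), so partial sums are mapped into the span of
the modes of nonnegative frequency. *)
Lemma mono_op_hardy_series a : rapid a -> hardy (dapply mono_op (hardy_series a)).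
Proof.
move=> ra; have ss := hardy_series_smooth ra.
pose p N t := zmode k t * \sum_(r < d.+1) q`_r * hardy_psum (fun n => n%:R ^+ r * a n) N t.
apply: (@hardy_ucvg p); [exact: dapply_ccont|exact: dapply_periodic| |].
  move=> N.
  have -> : p N = fun t => \sum_(n < N) (q.[n%:R] * a n) * zmode (absz (n%:Z + k)) t.
    apply/funext => t; rewrite /p.
    under eq_bigr => r _ do rewrite /hardy_psum mulr_sumr.
    rewrite exchange_big mulr_sumr; apply: eq_bigr => n _ /=.
    have [nk|nk] := leP 0 (n%:Z + k).
      rewrite gez0_abs// addrC zmodeD (horner_coef_wide _ size_q) mulr_suml.
      by rewrite mulr_suml mulr_sumr; apply: eq_bigr => r _; ring.
    rewrite -(_ : q.[n%:Z%:~R] = q.[n%:R])// root_q; last first.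
      by rewrite crossingsP; lia.
    rewrite !mul0r.
    have -> : \sum_(r < d.+1) q`_r * (n%:R ^+ r * a n * zmode n t) =
        q.[n%:Z%:~R] * (a n * zmode n t).
      by rewrite (horner_coef_wide _ size_q) mulr_suml; apply: eq_bigr => r _; rewrite -!mulrA.
    by rewrite root_q ?mul0r ?mulr0// crossingsP; lia.
  exact: (span_sum (fun n : 'I_N => q.[n%:R] * a n) (fun n => (absz (n%:Z + k)))).
have -> : dapply mono_op (hardy_series a) = fun t => zmode k t *
    \sum_(r < d.+1) q`_r * hardy_series (fun n => n%:R ^+ r * a n) t.
  apply/funext => t; rewrite mono_op_apply; congr (_ * _); apply: eq_bigr => r _.
  by rewrite (iter_Dtheta_hardy_series r ra).2.
apply: (@ucvgM _ _ _ _ 1); first by move=> t; rewrite normc_zmode.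
apply: ucvg_sum => r; apply: ucvgZ; apply: hardy_series_ucvg.
by have [] := iter_Dtheta_hardy_series r ra.
Qed.

Lemma mono_op_fourier_coef u m : circle_smooth u ->
  fourier_coef (dapply mono_op u) m = q.[(m - k)%:~R] * fourier_coef u (m - k).
Proof.
move=> su; rewrite /fourier_coef mulrA; congr (_ / _).
have -> : (fun t => dapply mono_op u t * zmode (- m) t) = fun t =>
    \sum_(r < d.+1) q`_r * (iter r (@Dtheta R) u t * zmode (- (m - k)) t).
  apply/funext => t; rewrite mono_op_apply opprB zmodeD mulrAC mulr_sumr.
  by apply: eq_bigr => r _; ring.
have ci r : ccont (fun t => iter r (@Dtheta R) u t * zmode (- (m - k)) t).
  by apply: ccontM; [exact/circle_smooth_ccont/iter_Dtheta_smooth|exact: zmode_ccont].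
rewrite circle_integral_sum; last by move=> r; exact: ccontZ.
rewrite (horner_coef_wide _ size_q) mulr_suml; apply: eq_bigr => r _.
by rewrite circle_integralZ ?circle_integral_iter_Dtheta ?mulrA//; exact: ccont_cintegrable.
Qed.

(** With v the projection of u, the images of u and v have the same Fourier
coefficients at every m >= 0: these are q(m - k) times the coefficients of u and v
at m - k, which differ only when m - k is negative, where q(m - k) = 0. *)
Lemma mono_op_commutes : commutes_with_szego mono_op.
Proof.
move=> u su; have ra := fourier_coef_rapid su; have sv := hardy_series_smooth ra.
exists (hardy_series (fun n => fourier_coef u n)); split; [exact: sv|exact: szego_hardy_series|].
have cPu := dapply_ccont mono_op su; have cPv := dapply_ccont mono_op sv.
split; [exact: dapply_L2|exact: mono_op_hardy_series|].
move=> w; apply: hardy_ortho; first exact: ccontB.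
move=> n; rewrite L2innerBl//; last exact: zmode_ccont.
rewrite !L2inner_fourier_coef !mono_op_fourier_coef// -mulrBl -mulrBr fourier_coef_hardy_series//.
case E : (n%:Z - k) => [m|m]; first by rewrite subrr mulr0 mul0r.
by rewrite root_q ?mul0r// crossingsP; lia.
Qed.

End Monomial_operator.

End Operators.

(** * Linear spans *)

Section Span.
Variables (K : pzRingType) (V : lmodType K).
Implicit Types A B : set V.

(** Linear subspaces, for sets that are not given as spans. *)
Definition lin_closed B :=
  [/\ B 0, (forall v w, B v -> B w -> B (v + w)) & (forall c v, B v -> B (c *: v))].

Lemma lin_closed_sum B (I : Type) (s : seq I) (F : I -> V) : lin_closed B ->
  (forall i, B (F i)) -> B (\sum_(i <- s) F i).
Proof. by move=> [B0 BD _] h; elim/big_ind: _. Qed.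

Lemma lin_span_min A B : lin_closed B -> A `<=` B -> lin_span A `<=` B.
Proof.
move=> hB AB v [n [c [f [hf ->]]]]; apply: lin_closed_sum => // i.
by have [_ _ BZ] := hB; apply/BZ/AB.
Qed.

Lemma sub_lin_span A : A `<=` lin_span A.
Proof.
by move=> v Av; exists 1%N, (fun=> 1), (fun=> v); rewrite big_ord1 scale1r.
Qed.

(** Concatenation of the two families handles the sum. *)
Lemma lin_span_closed A : lin_closed (lin_span A).
Proof.
split.
- exists 0%N, (fun=> 0), (fun=> 0); split; first by case.
  by rewrite big_ord0.
- move=> v w [n [c [f [hf ->]]]] [m [c' [f' [hf' ->]]]].
  pose pick T (g : 'I_n -> T) (g' : 'I_m -> T) i :=
    match fintype.split i with inl l => g l | inr r => g' r end.
  exists (n + m)%N, (pick _ c c'), (pick _ f f'); split.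
    by move=> i; rewrite /pick; case: fintype.split.
  rewrite big_split_ord; congr (_ + _); apply: eq_bigr => i _.
    by rewrite /pick (unsplitK (inl i)).
  by rewrite /pick (unsplitK (inr i)).
- move=> z v [n [c [f [hf ->]]]]; exists n, (fun i => z * c i), f; split => //.
  by rewrite scaler_sumr; apply: eq_bigr => i _; rewrite scalerA.
Qed.

End Span.

(** * Symbols and polynomials on the cut space *)

Section Symbols.
Variable R : realType.
Notation C := R[i].
Notation T := ({nonneg R} * circle R)%type.
Implicit Types (x : T) (z : C) (k : int).

Notation Re := (@complex.Re R).
Notation Im := (@complex.Im R).
Notation zmode := (@zmode R).

(** A symbol is prescribed only at the points [circle_exp t]; surjectivity makes this
determine it everywhere. *)
Lemma circle_exp_surj (l : circle R) : exists t, l = circle_exp t.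
Proof.
case: l => [[a b] hl].
have ab : a ^+ 2 + b ^+ 2 = 1.
  have := hl; rewrite normc_def /= => /eqP /complexI h.
  by rewrite -[LHS]sqr_sqrtr ?h ?expr1n// addr_ge0// sqr_ge0.
have a1 : -1 <= a <= 1.
  by apply/andP; split; have := sqr_ge0 b; nra.
have ain : a \in `[-1, 1] by rewrite in_itv.
have sb : Num.sqrt (1 - a ^+ 2) = `|b|.
  by rewrite -ab addrAC subrr add0r sqrtr_sqr.
have [b0|b0] := leP 0 b.
  exists (acos a); apply: val_inj => /=; rewrite /expi acosK// sin_acos// sb.
  by rewrite ger0_norm.
exists (- acos a); apply: val_inj => /=; rewrite /expi cosN sinN acosK// sin_acos// sb.
by rewrite ltr0_norm// opprK.
Qed.

Definition monomial_symbol (d : nat) k : T -> C :=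
  fun x => ((x.1%:num)%:C)%C ^+ d * sval x.2 ^ k.

Notation symbols := (@restrict_nonneg R @` @commuting_symbols R).

(** The crossings of k provide |k| of the roots of q; the others may be chosen freely,
and 0 is as good as any. *)
Lemma monomial_symbol_commuting d k : (`|k| <= d)%N -> symbols (monomial_symbol d k).
Proof.
move=> kd.
(* the zeros pad the crossings of k to a list of length d *)
pose rs : seq C := [seq n%:~R | n <- crossings k] ++ nseq (d - `|k|) 0.
pose q := \prod_(x <- rs) ('X - x%:P).
have srs : size rs = d by rewrite size_cat size_map size_nseq size_crossings subnKC.
have sq : size q = d.+1 by rewrite size_prod_XsubC srs.
have qd : q`_d = 1.
  have /monicP : q \is monic by exact: monic_prod_XsubC.
  by rewrite lead_coefE sq.
have rq n : n \in crossings k -> q.[n%:~R] = 0.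
  move=> hn; apply/rootP; rewrite root_prod_XsubC mem_cat.
  by apply/orP; left; apply/mapP; exists n.
exists (fun y => (y.1%:C)%C ^+ d * sval y.2 ^ k); last by [].
exists (mono_op d k q); first by apply: mono_op_commutes => //; rewrite sq.
split; first by exists 0; rewrite /= qd mul1r /zmode expi0 exp1rz oner_eq0.
by move=> s t /=; rewrite qd mul1r mulrC.
Qed.

Lemma commuting_symbol_trig g : commuting_symbols g -> exists (d n : nat)
  (c : 'I_n -> C) (k : 'I_n -> int), (forall i, (`|k i| <= d)%N) /\
  restrict_nonneg g = \sum_(i < n) c i *: monomial_symbol d (k i).
Proof.
move=> [P hP [_ hg]]; have [c hc] := leading_coef_trig hP.
exists (dorder P), (dorder P).*2.+1, c, (fun i => i%:Z - (dorder P)%:Z); split.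
  by move=> i; have := ltn_ord i; lia.
apply/funext => -[s l]; have [t ->] := circle_exp_surj l.
rewrite fct_sumE /restrict_nonneg /= hg hc mulr_suml; apply: eq_bigr => i _.
by rewrite -mulrA; congr (_ * _); rewrite mulrC.
Qed.

(** The product of a square root of 1/lambda and the square root of s represents the
class [sigma].  Another choice of the square root of lambda changes its sign only. *)
Definition cut_coord x : C := (sqrtC (sval x.2))^-1 * ((Num.sqrt (x.1%:num))%:C)%C.

Lemma sigmaE x : sigma x = class_modZ2 (cut_coord x). Proof. by []. Qed.

Lemma cut_coord_sqr x : cut_coord x ^+ 2 = (sval x.2)^-1 * ((x.1%:num)%:C)%C.
Proof. by rewrite exprMn exprVn sqrtCK -rmorphXn /= sqr_sqrtr. Qed.

Lemma circleJ (l : circle R) : ((sval l)^*)%C = (sval l)^-1.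
Proof. by case: l => l /= /eqP hl; rewrite invc_norm hl expr1n invr1 mul1r. Qed.

Lemma cut_coord_norm x : cut_coord x * ((cut_coord x)^*)%C = ((x.1%:num)%:C)%C.
Proof.
rewrite -sqr_normc -normrX cut_coord_sqr normrM normfV.
case: x => s [l /= /eqP ->]; rewrite invr1 mul1r normc_def /= expr0n addr0 sqrtr_sqr.
by rewrite ger0_norm.
Qed.

(** Factor out the largest power of z zbar = s; what remains is a power of z^2 = s / lambda
or of zbar^2 = s lambda, according to the sign of k. *)
Lemma cut_coord_monomial x (a b d : nat) k : a%:Z = d%:Z - k -> b%:Z = d%:Z + k ->
  cut_coord x ^+ a * ((cut_coord x)^*)%C ^+ b = monomial_symbol d k x.
Proof.
move=> ha hb; set z := cut_coord x; set zc := (z^*)%C.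
have nz : z * zc = ((x.1%:num)%:C)%C by exact: cut_coord_norm.
have z2 : z ^+ 2 = (sval x.2)^-1 * ((x.1%:num)%:C)%C by exact: cut_coord_sqr.
have zc2 : zc ^+ 2 = sval x.2 * ((x.1%:num)%:C)%C.
  rewrite /zc -rmorphXn /= z2 rmorphM; congr (_ * _); last exact: conjc_real.
  by rewrite fmorphV /= circleJ invrK.
rewrite /monomial_symbol; case: k ha hb => m ha hb.
  have -> : b = (a + 2 * m)%N by lia.
  have -> : d = (a + m)%N by lia.
  rewrite exprD exprM zc2 mulrA -exprMn nz exprMn exprD -exprnP.
  by rewrite [sval _ ^+ m * _]mulrC mulrA.
have -> : a = (b + 2 * m.+1)%N by lia.
have -> : d = (b + m.+1)%N by lia.
rewrite exprD exprM z2 mulrAC -exprMn nz exprMn exprD NegzE -exprnN -exprVn.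
by rewrite [_^-1 ^+ _ * _]mulrC mulrA.
Qed.

Lemma class_oppr z : class_modZ2 (- z) = class_modZ2 z.
Proof. by apply/eqmodP; rewrite /= /sign_rel eqxx orbT. Qed.

Lemma repr_class z : repr (class_modZ2 z) = z \/ repr (class_modZ2 z) = - z.
Proof.
have : class_modZ2 (repr (class_modZ2 z)) = class_modZ2 z by exact: reprK.
by move/eqmodP => /orP[] /eqP; [left|right].
Qed.

Notation pullbacks := [set f \o @sigma R | f in @polynomials_modZ2 R].

Lemma pullbacks_closed : lin_closed (pullbacks : set (T -> C)).
Proof.
split.
- by exists (fun=> 0) => //; exists 0 => z; rewrite !horner0.
- move=> _ _ [f [p hp] <-] [f' [p' hp'] <-]; exists (fun y => f y + f' y) => //.
  by exists (p + p') => z; rewrite !hornerD hp hp'.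
- move=> c _ [f [p hp] <-]; exists (fun y => c * f y) => //.
  by exists (c%:P%:P * p) => z; rewrite hornerM hornerC hornerM hornerC hp.
Qed.

(** The exponents d - k and d + k have even sum, so the monomial in z and zbar does
not depend on the representative chosen in a class of the quotient. *)
Lemma monomial_symbol_pullback d k : (`|k| <= d)%N -> pullbacks (monomial_symbol d k).
Proof.
move=> kd; pose a := absz (d%:Z - k); pose b := absz (d%:Z + k).
have ha : a%:Z = d%:Z - k by rewrite /a; lia.
have hb : b%:Z = d%:Z + k by rewrite /b; lia.
pose m (z : C) := z ^+ a * (z^*)%C ^+ b.
have mN z : m (- z) = m z.
  rewrite /m rmorphN /= (exprNn z) (exprNn (z^*)%C) mulrACA -exprD.
  by rewrite -signr_odd (_ : odd (a + b) = false) ?mul1r//; lia.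
have mE z : m (repr (class_modZ2 z)) = m z by case: (repr_class z) => ->.
exists (fun y => m (repr y)).
  exists (('X^a)%:P * 'X^b) => z; rewrite mE hornerM hornerC hornerXn hornerM hornerXn.
  by rewrite horner_exp hornerC.
by apply/funext => x; rewrite /= sigmaE mE; exact: cut_coord_monomial.
Qed.

(** The factor (1 + (-1)^(i+j)) / 2 selects the even monomials, which are the symbols
s^d lambda^k with d = (i + j) / 2 and k = (j - i) / 2. *)
Lemma even_monomial_span (i j : nat) :
  lin_span symbols (fun x => (1 + (-1) ^+ (i + j)) / 2 *
    (cut_coord x ^+ i * ((cut_coord x)^*)%C ^+ j)).
Proof.
have [S0 _ _] := lin_span_closed symbols.
have [oij|eij] := boolP (odd (i + j)).
  have -> : (fun x => (1 + (-1) ^+ (i + j)) / 2 *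
    (cut_coord x ^+ i * ((cut_coord x)^*)%C ^+ j)) = 0 => //.
  by apply/funext => x; rewrite -signr_odd oij expr1 subrr !mul0r.
pose d := (i + j)./2; pose k : int := d%:Z - i%:Z.
have dE : (d * 2 = i + j)%N by rewrite muln2 /d even_halfK.
have -> : (fun x => (1 + (-1) ^+ (i + j)) / 2 *
    (cut_coord x ^+ i * ((cut_coord x)^*)%C ^+ j)) = monomial_symbol d k.
  apply/funext => x; rewrite -signr_odd (negbTE eij) expr0 divff ?pnatr_eq0// mul1r.
  by apply: cut_coord_monomial; rewrite /k; lia.
by apply/sub_lin_span/monomial_symbol_commuting; rewrite /k; lia.
Qed.

Lemma horner2_coef (p : {poly {poly C}}) (z w : C) : p.[w%:P].[z] =
  \sum_(j < size p) \sum_(i < size p`_j) p`_j`_i * (z ^+ i * w ^+ j).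
Proof.
rewrite (horner_coef p) horner_sum; apply: eq_bigr => j _.
rewrite hornerM horner_exp hornerC horner_coef mulr_suml; apply: eq_bigr => i _.
by rewrite mulrA.
Qed.

(** The polynomial p representing f need not be even term by term; averaging its values
at z and - z, where f takes the same value, removes the odd monomials. *)
Lemma pullback_span : pullbacks `<=` lin_span symbols.
Proof.
move=> _ [f [p hp] <-]; have hS := lin_span_closed symbols.
have -> : f \o @sigma R = \sum_(j < size p) \sum_(i < size p`_j) p`_j`_i *:
    ((fun x => (1 + (-1) ^+ (i + j)) / 2 *
      (cut_coord x ^+ i * ((cut_coord x)^*)%C ^+ j)) : T -> C).
  apply/funext => x; rewrite fct_sumE /= sigmaE; set z := cut_coord x.
  have -> : f (class_modZ2 z) =
      (f (class_modZ2 z) + f (class_modZ2 (- z))) / 2.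
    by rewrite class_oppr; field.
  rewrite !hp rmorphN /= !horner2_coef -big_split mulr_suml /=; apply: eq_bigr => j _.
  rewrite fct_sumE -big_split mulr_suml /=; apply: eq_bigr => i _.
  rewrite -[RHS]/(p`_j`_i * _) (exprNn z) (exprNn (z^*)%C) mulrACA -exprD.
  by field.
apply: lin_closed_sum => // j; apply: lin_closed_sum => // i.
by have [_ _ SZ] := hS; apply: SZ; exact: even_monomial_span.
Qed.

Lemma symbols_pullback : symbols `<=` pullbacks.
Proof.
move=> _ [g /commuting_symbol_trig[d [n [c [k [kd ->]]]]] <-].
have hS := pullbacks_closed; apply: lin_closed_sum => // i.
by have [_ _ SZ] := hS; apply: SZ; exact: monomial_symbol_pullback.
Qed.

End Symbols.

Theorem theorem2p4 (R : realType) :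
  @lin_span R[i] _ (@restrict_nonneg R @` @commuting_symbols R)
  = [set f \o @sigma R | f in @polynomials_modZ2 R].
Proof.
apply/seteqP; split.
  apply: lin_span_min; [exact: pullbacks_closed|exact: symbols_pullback].
exact: pullback_span.
Qed.
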